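(* Let $A$ be a graded pseudo-Frobenius algebra, with $(e_i)_{i\in I}$ as a weakly basic distinguished family of orthogonal idempotents. The following assertions hold: 1. $\mathrm{Soc}_{gr}({}_AA)=\mathrm{Soc}_{gr}(A_A)$. (This ideal is denoted $\mathrm{Soc}_{gr}(A)$.) 2. All graded Nakayama forms for $A$ have the same Nakayama permutation. It assigns to each $i\in I$ the unique $\nu(i)\in I$ such that $e_i\mathrm{Soc}_{gr}(A)e_{\nu(i)}\neq 0$. 3. In contrast, the graded Nakayama forms for $A$ do not in general all have the same degree map: there exist an abelian group $H$ and an $H$-graded pseudo-Frobenius $K$-algebra admitting two graded Nakayama forms with different degree maps.
   Context: $K$ is a fixed field and $H$ an abelian group, written additively. Algebras are associative $K$-algebras, not necessarily unital. A *graded algebra with enough idempotents* is an $H$-graded algebra $A=\oplus_{h\in H}A_h$ having a family $(e_i)_{i\in I}$ of nonzero orthogonal idempotents, homogeneous of degree $0$, with $\oplus_{i\in I}e_iA=A=\oplus_{i\in I}Ae_i$ (a *distinguished family* ). $A$ is *locally finite dimensional* if $\dim_K e_iA_he_j<\infty$ for all $i,j\in I$, $h\in H$. Modules are unital; $A\text{-}Gr$ (resp. $Gr\text{-}A$) is the category of $H$-graded left (resp. right) $A$-modules with degree $0$ homomorphisms. The graded Jacobson radical $J^{gr}(A)$ is the intersection of all maximal graded left ideals of $A$ (equivalently, of all maximal graded right ideals). A locally finite dimensional graded algebra with enough idempotents is *weakly basic* if it has a distinguished family $(e_i)_{i\in I}$ (called *weakly basic* ) such that each $e_iA_0e_i$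 is local and $e_iAe_j\subseteq J^{gr}(A)$ for all $i\neq j$. For graded $K$-vector spaces $V,W$ with finite dimensional homogeneous components, put $D(V)=\oplus_h\mathrm{Hom}_K(V_h,K)$. A bilinear form $V\times W\to K$ is *of degree $d\in H$* if $(V_h,W_k)\neq 0$ implies $h+k=d$; such a form is *nondegenerate* if the induced maps $W\to D(V)$ and $V\to D(W)$ are bijective. A *graded Nakayama form* for a weakly basic $A$ is a bilinear form $(-,-):A\times A\to K$ such that: (i) $(ab,c)=(a,bc)$ for all $a,b,c\in A$; (ii) for each $i\in I$ there is a unique $\nu(i)\in I$ with $(e_iA,Ae_{\nu(i)})\neq 0$, and $\nu:I\to I$ is a bijection (the *Nakayama permutation* ); (iii) there is a map $\mathbf h:I\to H$ (the *degree map* ) such that, for all $i,j\in I$, the induced form $e_iAe_j\times e_jAe_{\nu(i)}\to K$ is a nondegenerate graded bilinear form of degree $\mathbf h(i)$. A graded algebra is *graded pseudo-Frobenius* if it is weakly basic (in particular locally finite dimensional) and admits a graded Nakayama form; equivalently, if it is weakly basic and in $A\text{-}Gr$ (resp. $Gr\text{-}A$) the finitely generated projective objects coincide with the finitely cogenerated injective ones. $\mathrm{Soc}_{gr}(M)$ is the graded socle of a graded module $M$ (sum of its graded-simple submodules). ${}_AA$, $A_A$ denote $A$ as a left, right graded module over itself. *)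

(* Defs.v *)
From mathcomp Require Import all_boot all_algebra.
From mathcomp Require Import sesquilinear.
From mathcomp Require Import boolp classical_sets functions cardinality fsbigop.

Set Implicit Arguments.
Unset Strict Implicit.
Unset Printing Implicit Defensive.

Import GRing.Theory.

Declare Scope gralg_scope.
Local Open Scope classical_set_scope.
Local Open Scope ring_scope.

(* Subspaces, gradings and ideals are Prop-valued subsets [set M] of an ambient
   vector space: no decidability or finiteness of dimension is available. *)

Definition subspace (K : fieldType) (M : lmodType K) (S : set M) : Prop :=
  S 0 /\ forall (c : K) (u v : M), S u -> S v -> S (c *: u + v).

Definition fin_dim (K : fieldType) (M : lmodType K) (S : set M) : Prop :=
  exists (n : nat) (b : 'I_n -> M), (forall k, S (b k)) /\
    forall x, S x -> exists c : 'I_n -> K, x = \sum_(k < n) c k *: b k.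

(* S is the internal direct sum of the subspaces N j. The finiteness condition
   cannot be dropped: \sum_(j \in setT) f j is 0 when f has infinite support. *)
Definition direct_sum (K : fieldType) (M : lmodType K) (J : choiceType)
    (N : J -> set M) (S : set M) : Prop :=
  [/\ subspace S,
      forall j, subspace (N j) /\ N j `<=` S
    & forall x, S x -> exists! f : J -> M,
        [/\ forall j, N j (f j),
            finite_set [set j | f j != 0]
          & x = \sum_(j \in setT) f j]].

(* Not necessarily unital: MathComp rings have a unit, hence this record. *)
Record gradedAlgebra (K : fieldType) (H : zmodType) := GradedAlgebra {
  gsort :> lmodType K;
  gmul : {bilinear gsort -> gsort -> gsort};
  gmulA : associative gmul;
  gcomp : H -> set gsort;
  gcomp_direct : direct_sum gcomp setT;
  gcompM : forall (h k : H) (a b : gsort),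
    gcomp h a -> gcomp k b -> gcomp (h + k) (gmul a b)
}.

Arguments gcomp {K H} A h _ : rename.

Notation "a ** b" := (gmul _ a b)
  (at level 40, left associativity) : gralg_scope.
Local Open Scope gralg_scope.

Definition maximal_in (T : Type) (P : set (set T)) (S M : set T) : Prop :=
  [/\ P M, M `<` S & forall N, P N -> N `<` S -> M `<=` N -> N = M].

Section GradedModule.
Context (K : fieldType) (H : zmodType) (A : gradedAlgebra K H).
(* A graded A-module is given by its homogeneous components Mh and its action.
   Right modules are covered too, since no axiom on the action is involved in
   the notions below. *)
Context (M : lmodType K) (Mh : H -> set M) (act : A -> M -> M).

Definition graded_submodule (N : set M) : Prop :=
  [/\ subspace N, forall a x, N x -> N (act a x)
    & direct_sum (fun h => N `&` Mh h) N].

Definition graded_simple_submodule (S : set M) : Prop :=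
  [/\ graded_submodule S, S <> [set 0]
    & forall N, graded_submodule N -> N `<=` S -> N = [set 0] \/ N = S].

Definition graded_socle : set M :=
  [set x | exists s : seq M,
     (forall y, y \in s -> exists2 S, graded_simple_submodule S & S y) /\
     x = \sum_(y <- s) y].

End GradedModule.

Section GradedAlgebraTheory.
Context (K : fieldType) (H : zmodType) (A : gradedAlgebra K H).

(* An additive subgroup of A stable under left (or right) multiplication by A
   is automatically a K-subspace and a unital module when A has enough
   idempotents. *)
Definition graded_left_ideal : set (set A) :=
  graded_submodule (gcomp A) (fun a x => a ** x).

Definition left_graded_socle : set A :=
  graded_socle (gcomp A) (fun a x => a ** x).

Definition right_graded_socle : set A :=
  graded_socle (gcomp A) (fun a x => x ** a).

Definition graded_jacobson : set A :=
  [set x | forall L, maximal_in graded_left_ideal setT L -> L x].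

Definition left_ideal_of (S L : set A) : Prop :=
  [/\ subspace L, L `<=` S & forall a x, S a -> L x -> L (a ** x)].

(* For a subalgebra S with its own unit, e.g. the corner e A_0 e. *)
Definition local_subalgebra (S : set A) : Prop :=
  exists! L : set A, maximal_in (left_ideal_of S) S L.

Definition peirce (x y : A) : set A := [set x ** a ** y | a in setT].

Definition peirce_comp (x : A) (h : H) (y : A) : set A :=
  [set x ** a ** y | a in gcomp A h].

Section Families.
Context (I : choiceType) (e : I -> A).

Definition distinguished_family : Prop :=
  [/\ forall i, e i != 0 /\ gcomp A 0 (e i),
      forall i, e i ** e i = e i,
      forall i j, i != j -> e i ** e j = 0,
      direct_sum (fun i => [set e i ** a | a in setT]) setT
    & direct_sum (fun i => [set a ** e i | a in setT]) setT].

Definition weakly_basic_family : Prop :=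
  [/\ distinguished_family,
      forall i j h, fin_dim (peirce_comp (e i) h (e j)),
      forall i, local_subalgebra (peirce_comp (e i) 0 (e i))
    & forall i j, i != j -> peirce (e i) (e j) `<=` graded_jacobson].

End Families.

(* For a graded subspace V of A, V_h is V `&` gcomp A h; in particular
   (e_i A e_j)_h = e_i A_h e_j since e_i, e_j have degree 0. *)

Definition form_of_degree (B : A -> A -> K) (V W : set A) (d : H) : Prop :=
  forall h k v w, (V `&` gcomp A h) v -> (W `&` gcomp A k) w ->
    B v w != 0 -> h + k = d.

(* phi restricted to V is an element of D(V); its values outside V are
   irrelevant. *)
Definition graded_dual (V : set A) (phi : A -> K) : Prop :=
  (forall c u v, V u -> V v -> phi (c *: u + v) = c * phi u + phi v) /\
  finite_set [set h | exists2 v, (V `&` gcomp A h) v & phi v != 0].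

(* The induced maps W -> D(V) and V -> D(W) are bijective; for a form having a
   degree they do take values in D(V) and D(W). *)
Definition nondegenerate_form (B : A -> A -> K) (V W : set A) : Prop :=
  (forall phi, graded_dual V phi ->
     exists! w, W w /\ forall v, V v -> B v w = phi v) /\
  (forall phi, graded_dual W phi ->
     exists! v, V v /\ forall w, W w -> B v w = phi w).

(* nu is the Nakayama permutation and hdeg the degree map of the form B; both
   are determined by B. *)
Definition graded_Nakayama_form (I : choiceType) (e : I -> A)
    (B : {biscalar A}) (nu : I -> I) (hdeg : I -> H) : Prop :=
  [/\ forall a b c, B (a ** b) c = B a (b ** c),
      forall i, unique (fun j => exists a b, B (e i ** a) (b ** e j) != 0)
                       (nu i),
      bijective nu
    & forall i j,
        form_of_degree B (peirce (e i) (e j)) (peirce (e j) (e (nu i)))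
          (hdeg i) /\
        nondegenerate_form B (peirce (e i) (e j)) (peirce (e j) (e (nu i)))].

Definition graded_pseudo_Frobenius : Prop :=
  exists (I : choiceType) (e : I -> A), weakly_basic_family e /\
    exists (B : {biscalar A}) (nu : I -> I) (hdeg : I -> H),
      graded_Nakayama_form e B nu hdeg.

End GradedAlgebraTheory.

Arguments graded_left_ideal {K H} A _.
Arguments left_graded_socle {K H} A _.
Arguments right_graded_socle {K H} A _.
Arguments graded_jacobson {K H} A _.
Arguments graded_pseudo_Frobenius {K H} A.

(* Main.v *)
From HB Require Import structures.
Require Import Defs.
From mathcomp Require Import all_boot all_algebra.
From mathcomp Require Import sesquilinear.
From mathcomp Require Import ring.
From mathcomp Require Import boolp classical_sets functions cardinality fsbigop.

Set Implicit Arguments.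
Unset Strict Implicit.
Unset Printing Implicit Defensive.

Import GRing.Theory.

Local Open Scope classical_set_scope.
Local Open Scope ring_scope.
Local Open Scope gralg_scope.

(** Write [J] for the graded radical of [A]. A homogeneous element of
    [e_i A e_j] is either in [J], or else [i = j] and it is invertible in the
    corner [e_i A e_i]: this dichotomy is what the locality of the algebras
    [e_i A_0 e_i] and the inclusions of [e_i A e_j] in the radical amount to
    ([radical_or_unit]). It gives a graded Nakayama lemma, from which the left
    graded socle is [{x | J x = 0}] ([left_graded_socleE]) and, in the opposite
    algebra, the right graded socle is [{x | x J = 0}].

    Let now [B] be a Nakayama form with permutation [nu]. If [J x = 0], then
    [e_i x e_(nu k)] is orthogonal to [e_k A e_i], which is contained in [J]
    unless [k = i]; by nondegeneracy [e_i x e_j] vanishes unless [j = nu i]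
    ([annihilated_support]). For [y] in [e_i A e_(nu i)] the form provides
    adjoints between the corners of [e_i] and of [e_(nu i)],
    [B (a y) v = B y (v w)] ([form_adjoint]); adjoints of units are units
    ([adjoint_unit]), so [J]-elements correspond to [J]-elements, and [J y = 0]
    is equivalent to [y J = 0]. Hence both socles agree. Finally
    [e_i Soc e_(nu i)] is not zero, because the linear functional on
    [e_(nu i) A_0 e_(nu i)] that kills the maximal ideal and is [1] at the
    idempotent is represented by one of its elements
    ([right_annihilated_nonzero]). Therefore [nu] is read off from the socle and
    does not depend on the form.

    The Nakayama form need not be given on the family under consideration. Two
    basic families are conjugate up to a bijection of their index sets, by a
    Krull-Schmidt argument ([equivalent_idem_exists]), and since the socle is a
    two-sided ideal its pattern is carried along this bijection
    ([socle_permutation_transfer]).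

    Degree maps differ already on the group algebra of [Z/2], graded by [Z/2]:
    both coefficients of the product [a b] define a Nakayama form, one of degree
    [0] and one of degree [1]. *)

(** * Zorn's lemma for sets and for subspaces *)

(** Zorn's lemma above a prescribed set [W]: only nonempty chains have to be
    considered, as the union of the empty one is replaced by [W]. *)
Lemma maximal_above (T : Type) (Q : set (set T)) (W : set T) :
    Q W ->
    (forall F, F `<=` Q -> F !=set0 -> total_on F subset ->
       Q (\bigcup_(X in F) X)) ->
  exists M, [/\ Q M, W `<=` M & forall N, Q N -> M `<=` N -> N = M].
Proof.
move=> QW chain.
have [F FQ Ftot|M [QM maxM]] := @Zorn_bigcup T [set X | Q (W `|` X)].
  have [F0|/eqP/set0P[X0 FX0]] := pselect (F = set0).
    by rewrite /= F0 bigcup_set0 setU0.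
  have -> : [set X | Q (W `|` X)] (\bigcup_(X in F) X) =
            Q (\bigcup_(X in [set W `|` X | X in F]) X).
    congr Q; apply/seteqP; split => [x [Wx|[X FX Xx]]|x [_ [X FX <-] [Wx|Xx]]].
    - by exists (W `|` X0); [exists X0|left].
    - by exists (W `|` X); [exists X|right].
    - by left.
    - by right; exists X.
  apply: chain => [_ [X FX <-]||]; first exact: FQ.
    by exists (W `|` X0); exists X0.
  move=> _ _ [X FX <-] [Y FY <-].
  by have [XY|YX] := Ftot _ _ FX FY; [left|right]; apply: setUS.
exists (W `|` M); split; first exact: QM.
   by move=> x; left.
move=> N QN MN; apply/seteqP; split => //.
have WN : W `|` N = N by apply/setUidPr => x Wx; apply: MN; left.
apply: contrapT => NM; apply: (maxM N); last by rewrite /= WN.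
split; first by move=> x Mx; apply: MN; right.
by move=> NM'; apply: NM => x Nx; right; apply: NM'.
Qed.

Section Subspaces.
Context (K : fieldType) (M : lmodType K).
Implicit Types S W : set M.

Lemma subspaceD S x y : subspace S -> S x -> S y -> S (x + y).
Proof. by move=> [_ lS] Sx Sy; rewrite -[x]scale1r; apply: lS. Qed.

Lemma subspaceZ S c x : subspace S -> S x -> S (c *: x).
Proof. by move=> [S0 lS] Sx; rewrite -[c *: x]addr0; apply: lS. Qed.

Lemma subspaceB S x y : subspace S -> S x -> S y -> S (x - y).
Proof. by move=> [_ lS] Sx Sy; rewrite addrC -scaleN1r; apply: lS. Qed.

Lemma subspace_sum S (J : Type) (s : seq J) (f : J -> M) :
  subspace S -> (forall j, S (f j)) -> S (\sum_(j <- s) f j).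
Proof.
move=> sS Sf; elim/big_rec: _ => [|j x _]; first exact: sS.1.
exact: subspaceD.
Qed.

Lemma subspace_bigcup (F : set (set M)) :
  F !=set0 -> total_on F subset -> (forall X, F X -> subspace X) ->
  subspace (\bigcup_(X in F) X).
Proof.
move=> [X0 FX0] Ftot sF; split; first by exists X0 => //; apply: (sF _ FX0).1.
move=> c u v [X FX Xu] [Y FY Yv].
have [XY|YX] := Ftot _ _ FX FY.
  by exists Y => //; apply: (sF _ FY).2 => //; apply: XY.
by exists X => //; apply: (sF _ FX).2 => //; apply: YX.
Qed.

(** A maximal subspace avoiding [v] is a hyperplane, and the coefficient of [v]
    modulo this hyperplane is the functional. *)
Lemma separating_functional (W : set M) (v : M) :
  subspace W -> ~ W v ->
  exists phi : M -> K,
    [/\ forall c x y, phi (c *: x + y) = c * phi x + phi y,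
        forall x, W x -> phi x = 0 & phi v = 1].
Proof.
move=> sW Wv.
have [F FQ Fn0 Ftot|X [[sX Xv] WX maxX]] :=
    @maximal_above M [set X | subspace X /\ ~ X v] W (conj sW Wv).
  split; first by apply: subspace_bigcup => // X /FQ[].
  by move=> [X /FQ[]].
have comb u c a b x y :
    X (x - a *: u) -> X (y - b *: u) -> X (c *: x + y - (c * a + b) *: u).
  move=> Xa Xb; have := sX.2 c _ _ Xa Xb.
  by rewrite scalerBr scalerA scalerDl opprD addrACA.
have coefP x : exists c : K, X (x - c *: v).
  have [Xx|nXx] := pselect (X x); first by exists 0; rewrite scale0r subr0.
  pose N : set M := [set z | exists c : K, X (z - c *: x)].
  have sN : subspace N.
    split; first by exists 0; rewrite scale0r subr0; apply: sX.1.
    by move=> c y z [a Xa] [b Xb]; exists (c * a + b); apply: comb.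
  have [c Xc] : N v.
    apply: contrapT => Nv; apply: nXx.
    rewrite -(maxX N (conj sN Nv)).
      by exists 1; rewrite scale1r subrr; apply: sX.1.
    by move=> z Xz; exists 0; rewrite scale0r subr0.
  have c0 : c != 0.
    by apply: contra_notN Xv => /eqP c0; move: Xc; rewrite c0 scale0r subr0.
  exists c^-1; have := subspaceZ (- c^-1) sX Xc.
  by rewrite scaleNr scalerBr scalerA mulVf // scale1r opprB.
have coef_uniq a b x : X (x - a *: v) -> X (x - b *: v) -> a = b.
  move=> Xa Xb; apply/eqP; rewrite -subr_eq0; apply: contra_notT Xv => ab.
  rewrite -[v]scale1r -(mulVf ab) -scalerA; apply: subspaceZ => //.
  have := subspaceB sX Xb Xa.
  by rewrite opprB addrC addrA subrK -scalerBl.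
pose phi x := sval (cid (coefP x)).
have phiP x : X (x - phi x *: v) by rewrite /phi; case: cid.
exists phi; split.
- by move=> c x y; apply: coef_uniq (phiP _) _; apply: comb.
- move=> x /WX Xx; apply: coef_uniq (phiP _) _.
  by rewrite scale0r subr0.
- apply: coef_uniq (phiP _) _.
  by rewrite scale1r subrr; apply: sX.1.
Qed.

End Subspaces.

(** * Homogeneous components *)

Section FiniteSupport.
Context (V : zmodType).

Lemma fsum_wider (J : choiceType) (f : J -> V) (s : seq J) :
  uniq s -> (forall j, j \notin s -> f j = 0) ->
  \sum_(j \in setT) f j = \sum_(j <- s) f j.
Proof.
move=> us f0; rewrite (fsbigE s) //; last by move=> j _; apply: f0.
by apply: eq_bigl => j; rewrite in_setT.
Qed.

Lemma fsum_seq (J : choiceType) (f : J -> V) :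
  finite_set [set j | f j != 0] ->
  exists s : seq J, [/\ uniq s, forall j, j \notin s -> f j = 0
    & \sum_(j \in setT) f j = \sum_(j <- s) f j].
Proof.
move=> /finite_seqP[s fs]; exists (undup s).
have f0 j : j \notin undup s -> f j = 0.
  rewrite mem_undup => js; apply/eqP; apply: contraNT js => fj.
  by suff : [set` s] j by []; rewrite -fs.
by split=> //; [apply: undup_uniq|apply: fsum_wider => //; apply: undup_uniq].
Qed.

Lemma finite_support_seq (J : choiceType) (f : J -> V) (s : seq J) :
  (forall j, j \notin s -> f j = 0) -> finite_set [set j | f j != 0].
Proof.
move=> f0; apply: (@sub_finite_set _ _ [set` s]); last exact: finite_seq.
by move=> j /=; apply: contra_neqT => /f0.
Qed.

End FiniteSupport.

Section Components.
Context (K : fieldType) (H : zmodType) (A : gradedAlgebra K H).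
Implicit Types (a b c x y z : A) (g h k : H).

Lemma gmulDl a b x : (a + b) ** x = a ** x + b ** x.
Proof. exact: linearDl. Qed.
Lemma gmulDr x a b : x ** (a + b) = x ** a + x ** b.
Proof. exact: linearDr. Qed.
Lemma gmulBl a b x : (a - b) ** x = a ** x - b ** x.
Proof. exact: linearBl. Qed.
Lemma gmulBr x a b : x ** (a - b) = x ** a - x ** b.
Proof. exact: linearBr. Qed.
Lemma gmul0l x : 0 ** x = 0 :> A.
Proof. exact: linear0l. Qed.
Lemma gmul0r x : x ** 0 = 0 :> A.
Proof. exact: linear0r. Qed.
Lemma gmulZl (c : K) a x : (c *: a) ** x = c *: (a ** x).
Proof. exact: linearZl_LR. Qed.
Lemma gmulZr (c : K) x a : x ** (c *: a) = c *: (x ** a).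
Proof. exact: linearZr_LR. Qed.

Lemma gcomp_subspace h : subspace (gcomp A h).
Proof. by have [_ sub _] := gcomp_direct A; case: (sub h). Qed.

Lemma components_exist x : exists f : H -> A,
  [/\ forall h, gcomp A h (f h), finite_set [set h | f h != 0]
    & x = \sum_(h \in setT) f h].
Proof.
have [_ _ /(_ x Logic.I)[f [fP _]]] := gcomp_direct A.
by exists f.
Qed.

Definition hcomp h x : A := sval (cid (components_exist x)) h.

Lemma hcomp_in h x : gcomp A h (hcomp h x).
Proof. by rewrite /hcomp; case: cid => f []. Qed.

Lemma hcomp_fin x : finite_set [set h | hcomp h x != 0].
Proof. by rewrite /hcomp; case: cid => f []. Qed.

Lemma hcomp_fsum x : x = \sum_(h \in setT) hcomp h x.
Proof. by rewrite /hcomp; case: cid => f []. Qed.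

Lemma hcomp_unique x (f : H -> A) :
  (forall h, gcomp A h (f h)) -> finite_set [set h | f h != 0] ->
  x = \sum_(h \in setT) f h -> forall h, hcomp h x = f h.
Proof.
move=> fA ffin fx h; have [_ _ /(_ x Logic.I)[f' [_ f'U]]] := gcomp_direct A.
have <- : f' = f by apply: f'U.
suff /(congr1 (@^~ h)) /= -> : f' = hcomp ^~ x by [].
by apply: f'U; split; [move=> ?; apply: hcomp_in|apply: hcomp_fin|
  apply: hcomp_fsum].
Qed.

Lemma hcomp_seq x : exists s : seq H, [/\ uniq s,
  forall h, h \notin s -> hcomp h x = 0 & x = \sum_(h <- s) hcomp h x].
Proof.
have [s [us s0 sx]] := fsum_seq (hcomp_fin x).
by exists s; rewrite -sx -hcomp_fsum.
Qed.

Lemma hcomp_linear h (c : K) x y :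
  hcomp h (c *: x + y) = c *: hcomp h x + hcomp h y.
Proof.
have [s [us s0 _]] := hcomp_seq x; have [t [ut t0 _]] := hcomp_seq y.
pose r := undup (s ++ t); have ur : uniq r by apply: undup_uniq.
have [rs rt] : (forall k, k \notin r -> hcomp k x = 0) /\
               (forall k, k \notin r -> hcomp k y = 0).
  by split=> k; rewrite mem_undup mem_cat negb_or => /andP[/s0 + /t0].
have r0 k : k \notin r -> c *: hcomp k x + hcomp k y = 0.
  by move=> kr; rewrite rs // rt // scaler0 addr0.
apply: (hcomp_unique (f := fun k => c *: hcomp k x + hcomp k y)).
- by move=> k; apply: (gcomp_subspace k).2; apply: hcomp_in.
- exact: finite_support_seq r0.
- rewrite (fsum_wider ur r0) big_split /= -scaler_sumr.
  by rewrite -(fsum_wider ur rs) -(fsum_wider ur rt) -!hcomp_fsum.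
Qed.

Lemma hcompD h x y : hcomp h (x + y) = hcomp h x + hcomp h y.
Proof. by have := hcomp_linear h 1 x y; rewrite !scale1r. Qed.

Lemma hcomp0 h : hcomp h 0 = 0.
Proof. by apply: (addrI (hcomp h 0)); rewrite -hcompD !addr0. Qed.

Lemma hcompZ h (c : K) x : hcomp h (c *: x) = c *: hcomp h x.
Proof. by have := hcomp_linear h c x 0; rewrite hcomp0 !addr0. Qed.

Lemma hcompB h x y : hcomp h (x - y) = hcomp h x - hcomp h y.
Proof. by rewrite addrC -scaleN1r hcomp_linear scaleN1r addrC. Qed.

Lemma hcomp_homog h k x : gcomp A k x -> hcomp h x = if h == k then x else 0.
Proof.
move=> xk; pose f g := if g == k then x else 0.
have f0 g : g \notin [:: k] -> f g = 0.
  by rewrite inE /f; case: eqP.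
apply: (hcomp_unique (f := f)); last 2 first.
- exact: finite_support_seq f0.
- by rewrite (fsum_wider _ f0) // big_seq1 /f eqxx.
- by move=> g; rewrite /f; case: eqP => [->//|_]; apply: (gcomp_subspace g).1.
Qed.

Lemma hcomp_id h x : gcomp A h x -> hcomp h x = x.
Proof. by move=> xh; rewrite (hcomp_homog h xh) eqxx. Qed.

Lemma homog_ind (P : A -> Prop) :
  P 0 -> (forall x y, P x -> P y -> P (x + y)) ->
  (forall h x, gcomp A h x -> P x) -> forall x, P x.
Proof.
move=> P0 PD Ph x; have [s [_ _ ->]] := hcomp_seq x.
by elim/big_rec: _ => [//|h y _ Py]; apply: PD => //; apply: Ph (hcomp_in h x).
Qed.

Lemma subspace_hcomp (S : set A) x :
  subspace S -> (forall h, S (hcomp h x)) -> S x.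
Proof.
by move=> sS Sx; have [s [_ _ ->]] := hcomp_seq x; apply: subspace_sum.
Qed.

Lemma hcompMl g h a x :
  gcomp A g a -> hcomp (g + h) (a ** x) = a ** hcomp h x.
Proof.
move=> ag; move: x; apply: homog_ind => [|x y IHx IHy|k x xk].
- by rewrite gmul0r !hcomp0 gmul0r.
- by rewrite gmulDr !hcompD IHx IHy gmulDr.
rewrite (hcomp_homog _ (gcompM ag xk)) (hcomp_homog _ xk).
by rewrite (inj_eq (addrI g)); case: ifP => // _; rewrite gmul0r.
Qed.

Lemma hcompMr g h a x :
  gcomp A g a -> hcomp (h + g) (x ** a) = hcomp h x ** a.
Proof.
move=> ag; move: x; apply: homog_ind => [|x y IHx IHy|k x xk].
- by rewrite gmul0l !hcomp0 gmul0l.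
- by rewrite gmulDl !hcompD IHx IHy gmulDl.
rewrite (hcomp_homog _ (gcompM xk ag)) (hcomp_homog _ xk).
by rewrite (inj_eq (addIr g)); case: ifP => // _; rewrite gmul0l.
Qed.

Section Submodules.
Context (act : A -> A -> A).

(** The existence of homogeneous decompositions inside [N] is membership of the
    homogeneous components: decompositions in [N] are also decompositions in
    [A], where they are unique. *)
Lemma graded_submoduleP (N : set A) :
  graded_submodule (gcomp A) act N <->
  [/\ subspace N, forall a x, N x -> N (act a x)
    & forall h x, N x -> N (hcomp h x)].
Proof.
split=> [[sN actN [_ _ dec]]|[sN actN hN]]; split => //.
  move=> h x Nx; have [f [[fN ffin fx] _]] := dec x Nx.
  rewrite (hcomp_unique (f := f)) //; first by have [] := fN h.
  by move=> k; have [] := fN k.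
split=> // [h|x Nx].
  split=> [|x []//]; split.
    by split; [apply: sN.1|apply: (gcomp_subspace h).1].
  by move=> c u v [Nu uh] [Nv vh]; split; [apply: sN.2|apply: (gcomp_subspace h).2].
exists (hcomp ^~ x); split.
  split; [|exact: hcomp_fin|exact: hcomp_fsum].
  by move=> h; split; [apply: hN|apply: hcomp_in].
move=> f [fN ffin fx]; apply/funext => h; apply: hcomp_unique => //.
by move=> k; have [] := fN k.
Qed.

End Submodules.

End Components.

(** * Corners and local idempotents *)

Section Corners.
Context (K : fieldType) (H : zmodType) (A : gradedAlgebra K H).
Implicit Types (a b c e p q x y z : A) (g h k : H).

(** For idempotents [x] and [y] of degree [0] this is the set of all
    [x ** a ** y] with [a] of degree [h]; the fixed-point form is easier to
    compute with. *)
Definition corner x h y : set A :=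
  [set a | [/\ gcomp A h a, x ** a = a & a ** y = a]].

Definition homog_idem e : Prop := gcomp A 0 e /\ e ** e = e.

Lemma corner_peirce x h y :
  homog_idem x -> homog_idem y -> peirce_comp x h y = corner x h y.
Proof.
move=> [x0 xx] [y0 yy]; apply/seteqP; split=> a.
  move=> [b bh <-]; split.
  - by have := gcompM (gcompM x0 bh) y0; rewrite add0r addr0.
  - by rewrite !gmulA xx.
  - by rewrite -gmulA yy.
by move=> [ah xa ay]; exists a => //; rewrite xa ay.
Qed.

Lemma corner_subspace x h y : subspace (corner x h y).
Proof.
split; first by split; [apply: (gcomp_subspace A h).1|rewrite gmul0r|rewrite gmul0l].
move=> c u v [uh xu uy] [vh xv vy]; split; first exact: (gcomp_subspace A h).2.
  by rewrite gmulDr gmulZr xu xv.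
by rewrite gmulDl gmulZl uy vy.
Qed.

Lemma cornerM x g y h z a b :
  corner x g y a -> corner y h z b -> corner x (g + h) z (a ** b).
Proof.
move=> [ag xa ay] [bh yb bz]; split; first exact: gcompM.
  by rewrite gmulA xa.
by rewrite -gmulA bz.
Qed.

Lemma corner_idem e : homog_idem e -> corner e 0 e e.
Proof. by move=> [e0 ee]. Qed.

Lemma corner_sandwich x h y a :
  homog_idem x -> homog_idem y -> gcomp A h a -> corner x h y (x ** a ** y).
Proof. by move=> ix iy ah; rewrite -corner_peirce //; exists a. Qed.

Definition corner_unit e h a : Prop :=
  exists b, [/\ corner e (- h) e b, b ** a = e & a ** b = e].

(** Both members of the alternative are two-sided, so that the notion passes to
    the opposite algebra. *)
Definition local_idem e : Prop :=
  [/\ homog_idem e, e != 0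
    & forall a, corner e 0 e a -> corner_unit e 0 a \/ corner_unit e 0 (e - a)].

Lemma homog_degree0 e h : e != 0 -> gcomp A 0 e -> gcomp A h e -> h = 0.
Proof.
move=> en0 e0 eh; apply/eqP; apply: contraTT en0 => h0.
by rewrite negbK -(hcomp_id eh) (hcomp_homog h e0) (negbTE h0).
Qed.

Lemma local_idemP e f :
  local_idem e -> corner e 0 e f -> f ** f = f -> f != 0 -> f = e.
Proof.
move=> [[e0 ee] en0 loc] fe ff fn0; have [_ ef _] := fe.
case: (loc f fe) => -[z [_ ze _]].
  by rewrite -ef -{1}ze -gmulA ff.
by move: fn0; rewrite -ef -{1}ze -gmulA gmulBl ef ff subrr gmul0r eqxx.
Qed.

(** [b a] is an idempotent of the corner of [e'], nonzero since [a b] is, and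
    the only such idempotent is [e']. *)
Lemma local_swap e e' h k a b :
  local_idem e -> local_idem e' -> corner e h e' a -> corner e' k e b ->
  a ** b = e -> k = - h /\ b ** a = e'.
Proof.
move=> [[e0 ee] en0 loc] loc' ah bk ab.
have hk : h + k = 0.
  by apply: (homog_degree0 en0) => //; have [] := cornerM ah bk; rewrite ab.
split; first by apply/eqP; rewrite -addr_eq0 addrC hk.
have [_ ea _] := ah.
apply: local_idemP => //.
- by have := cornerM bk ah; rewrite addrC hk.
- by rewrite !gmulA -(gmulA b) ab -gmulA ea.
- apply: contraNneq en0 => ba.
  by rewrite -ee -{2}ab -{1}ab !gmulA -(gmulA a) ba gmul0r gmul0l.
Qed.

(** [local_swap] rotates the product [p a q] and shows that [q p] inverts [a] on
    either side. *)
Lemma local_factor_unit e g h k p a q :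
  local_idem e -> corner e g e p -> corner e h e a -> corner e k e q ->
  p ** a ** q = e -> corner_unit e h a.
Proof.
move=> loc pg ah qk paq; exists (q ** p).
have [_ qpa] := local_swap loc loc (cornerM pg ah) qk paq.
have [gE aqp] := local_swap loc loc pg (cornerM ah qk) (etrans (gmulA _ _ _) paq).
split; [|by rewrite -gmulA|by rewrite gmulA].
suff -> : - h = k + g by apply: cornerM qk pg.
by apply/eqP; rewrite eq_sym -addr_eq0 addrAC (addrC k) gE addNr.
Qed.

(** The maximal ideal of the local algebra [corner e 0 e], extended to [A]
    along the projection [y |-> (e y e)_0]. *)
Definition corner_nonunit e : set A :=
  [set y | ~ corner_unit e 0 (hcomp 0 (e ** y ** e))].

Lemma hcomp_corner e h x : homog_idem e ->
  hcomp h (e ** x ** e) = e ** hcomp h x ** e.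
Proof.
move=> [e0 _]; have := hcompMr h (e ** x) e0; rewrite addr0 => ->.
by have := hcompMl h x e0; rewrite add0r => ->.
Qed.

Lemma corner_hcomp e h x : homog_idem e -> corner e h e (hcomp h (e ** x ** e)).
Proof.
by move=> ie; rewrite hcomp_corner //; apply: corner_sandwich (hcomp_in _ _).
Qed.

Section LocalIdempotent.
Context (e : A) (loc : local_idem e).

Let ie : homog_idem e. Proof. by case: loc. Qed.

Lemma corner_unit_idem : corner_unit e 0 e.
Proof. by exists e; rewrite oppr0; case: ie => e0 ee; split. Qed.

Lemma corner_nonunit_idem : ~ corner_nonunit e e.
Proof.
by apply; case: (ie) => e0 ee; rewrite !ee hcomp_id //; apply: corner_unit_idem.
Qed.

Lemma corner_nonunit_subspace : subspace (corner_nonunit e).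
Proof.
have [[e0 ee] en0 loc'] := loc.
have nuD x y : corner_nonunit e x -> corner_nonunit e y ->
    corner_nonunit e (x + y).
  (* If z (a + b) = e, then z a or e - z a = z b is a unit. *)
  move=> nx ny; rewrite /corner_nonunit /= gmulDr gmulDl hcompD.
  set a := hcomp 0 _; set b := hcomp 0 _ => -[z [ze zab abz]].
  rewrite oppr0 in ze.
  have ae : corner e 0 e a by apply: corner_hcomp.
  have be : corner e 0 e b by apply: corner_hcomp.
  have e1 := corner_idem ie.
  have uD u : corner e 0 e u -> corner_unit e 0 (z ** u) -> corner_unit e 0 u.
    move=> ue [w [we wu _]]; rewrite oppr0 in we.
    apply: (local_factor_unit loc (cornerM we ze) ue e1).
    have [_ _ ->] : corner e (0 + 0 + 0) e (w ** z ** u).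
      exact: cornerM (cornerM we ze) ue.
    by rewrite -gmulA.
  have zae : corner e 0 e (z ** a).
    by have := cornerM ze ae; rewrite addr0.
  case: (loc' _ zae) => [/(uD _ ae)/nx//|].
  by rewrite -{2}zab gmulDr addrAC subrr add0r => /(uD _ be)/ny.
have nu0 : corner_nonunit e 0.
  rewrite /corner_nonunit /= gmul0r gmul0l hcomp0 => -[z [_ z0 _]].
  by move: en0; rewrite -z0 gmul0r eqxx.
split=> // c u v nu nv; apply: nuD => //.
have [->|c0] := eqVneq c 0; first by rewrite scale0r.
rewrite /corner_nonunit /= gmulZr gmulZl hcompZ => -[z [ze zu uz]].
apply: nu; exists (c *: z); split.
- exact: subspaceZ (corner_subspace _ _ _) ze.
- by rewrite gmulZl -gmulZr.
- by rewrite gmulZr -gmulZl.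
Qed.

End LocalIdempotent.

(** By Zorn's lemma every element outside the unique maximal left ideal [L] is
    left invertible; its left inverse is then a two-sided one because [L] cannot
    contain both an idempotent and its complement. *)
Lemma local_subalgebra_idem e :
  homog_idem e -> e != 0 -> local_subalgebra (peirce_comp e 0 e) -> local_idem e.
Proof.
move=> ie en0; rewrite corner_peirce //; have [e0 ee] := ie.
set S := corner e 0 e => -[L [[[sL LS LM] LpS maxL] uniqL]].
have sS : subspace S := corner_subspace e 0 e.
have SM a b : S a -> S b -> S (a ** b).
  by move=> Sa Sb; have := cornerM Sa Sb; rewrite addr0.
have Se : S e by apply: corner_idem.
have full X : left_ideal_of S X -> X e -> X = S.
  move=> [_ XS XM] Xe; apply/seteqP; split=> // a Sa.
  by have [_ _ <-] := Sa; apply: XM.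
have nLe : ~ L e.
  by move=> Le; case: LpS => _; apply; rewrite (full L).
(* Otherwise the proper left ideal S x is contained in a maximal one. *)
have linv x : S x -> ~ L x -> exists2 c, S c & c ** x = e.
  move=> Sx; apply: contra_notP => nox.
  pose W : set A := [set c ** x | c in S].
  have QW : left_ideal_of S W /\ ~ W e.
    split; last by move=> [c Sc cx]; apply: nox; exists c.
    split.
    - split; first by exists 0; [apply: sS.1|rewrite gmul0l].
      move=> c u v [a Sa <-] [b Sb <-]; exists (c *: a + b); first exact: sS.2.
      by rewrite gmulDl gmulZl.
    - by move=> _ [c Sc <-]; apply: SM.
    - by move=> a _ Sa [c Sc <-]; exists (a ** c); [apply: SM|rewrite gmulA].
  have [F FQ Fn0 Ftot|X [[iX nXe] WX maxX]] :=
      @maximal_above A [set X | left_ideal_of S X /\ ~ X e] W QW.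
    split; last by move=> [X /FQ[]].
    split.
    - by apply: subspace_bigcup => // X /FQ[[]].
    - by move=> a [X /FQ[[_ XS _] _]] /XS.
    - by move=> a b Sa [X FX Xb]; exists X => //; have [[_ _ XM] _] := FQ _ FX; apply: XM.
  have [_ XS _] := iX.
  suff -> : L = X by apply: WX; exists e => //; have [] := Sx.
  apply: uniqL; split => //; first by split=> // SX; apply: nXe; apply: SX.
  move=> N iN [_ NS] XN; apply: maxX => //; split=> // Ne.
  by apply: NS; rewrite (full N).
have unit_notL x : S x -> ~ L x -> corner_unit e 0 x.
  move=> Sx nLx; have [c Sc cx] := linv x Sx nLx.
  exists c; rewrite oppr0; split=> //.
  (* The idempotent f equals e if it is left invertible, and it vanishes if
     e - f is; in the second case e = (c x)(c x) = c f x = 0. *)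
  have Sf := SM _ _ Sx Sc; set f := x ** c in Sf *.
  have [_ ef _] := Sf.
  have ff : f ** f = f by rewrite /f !gmulA -(gmulA x) cx; have [_ _ ->] := Sx.
  have [Lf|nLf] := pselect (L f); last first.
    by have [d Sd df] := linv f Sf nLf; rewrite -ef -{1}df -gmulA ff.
  have [d Sd df] : exists2 d, S d & d ** (e - f) = e.
    apply: linv; first exact: subspaceB.
    by move=> Lef; apply: nLe; rewrite -(subrK f e); apply: subspaceD.
  have f0 : f = 0 by rewrite -ef -{1}df -gmulA gmulBl ef ff subrr gmul0r.
  have : c ** f ** x = e by rewrite /f gmulA cx -gmulA cx ee.
  by move: en0 => /eqP + /esym; rewrite f0 gmul0r gmul0l.
split=> // a Sa; have [La|nLa] := pselect (L a); last by left; apply: unit_notL.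
right; apply: unit_notL; first exact: subspaceB.
by move=> Lea; apply: nLe; rewrite -(subrK a e); apply: subspaceD.
Qed.

End Corners.

(** * The graded radical of a basic family *)

Section Families.
Context (K : fieldType) (H : zmodType) (A : gradedAlgebra K H).
Implicit Types (a b c x y z : A) (g h k : H).

(** Weak basicity freed from the graded Jacobson radical: the last clause says
    that for [i] and [j] distinct [A e_i] and [A e_j] are not isomorphic, even
    up to a shift of the grading. The conjunction is left-right symmetric. *)
Definition basic_family (I : choiceType) (e : I -> A) : Prop :=
  [/\ forall i, local_idem (e i),
      forall x, exists s : seq I, x = \sum_(i <- s) e i ** x,
      forall x, exists s : seq I, x = \sum_(i <- s) x ** e i
    & forall i j g h a b, corner (e i) g (e j) a -> corner (e j) h (e i) b ->
        a ** b = e i -> i = j].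

Lemma corner_nonunit_hcomp e h x :
  local_idem e -> corner_nonunit e x -> corner_nonunit e (hcomp h x).
Proof.
move=> loc nx; have [ie _ _] := loc; rewrite /corner_nonunit /=.
rewrite hcomp_corner // (hcomp_homog 0 (hcomp_in h x)); case: eqP => [<-|_].
  by rewrite -hcomp_corner.
rewrite gmul0r gmul0l => -[z [_ z0 _]].
by case: loc => _ /eqP + _; rewrite -z0 gmul0r.
Qed.

(** The elements [x] whose multiples [c x] all have nonunit component in the
    corner of [e] form the unique maximal graded submodule of [A e], enlarged by
    the [w] with [w e = 0]: a maximal graded left ideal. *)
Lemma jacobson_corner_nonunit e x c :
  local_idem e -> graded_jacobson A x -> corner_nonunit e (c ** x).
Proof.
move=> loc Jx; have [[e0 ee] en0 _] := loc.
have ie : homog_idem e by [].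
have sU := corner_nonunit_subspace loc.
pose M : set A := [set x | forall c, corner_nonunit e (c ** x)].
suff maxM : maximal_in (graded_left_ideal A) setT M by apply: (Jx M maxM).
have kerM w : w ** e = 0 -> M w.
  move=> we b; rewrite /corner_nonunit /= -!gmulA we !gmul0r.
  by have := sU.1; rewrite /corner_nonunit /= gmul0r gmul0l.
split.
- apply/graded_submoduleP; split.
  + split=> [b|a u v Mu Mv b]; first by rewrite gmul0r; apply: sU.1.
    by rewrite gmulDr gmulZr; apply: sU.2.
  + by move=> a y My b; rewrite gmulA.
  + move=> h y My b; move: b; apply: homog_ind.
    * by rewrite gmul0l; apply: sU.1.
    * by move=> a b na nb; rewrite gmulDl; apply: subspaceD.
    * by move=> g b bg; rewrite -(hcompMl _ _ bg); apply: corner_nonunit_hcomp.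
- split=> // /(_ e Logic.I e); rewrite ee; exact: corner_nonunit_idem.
move=> N /graded_submoduleP[sN NM Nh] [_ Nproper] MN.
apply/seteqP; split=> // y Ny; apply: contrapT => nMy; apply: Nproper => a _.
(* A unit in the corner of e, reached from y, gives w in N with w e = e. *)
have [b /contrapT[z [_ zu _]]] : exists b, ~ corner_nonunit e (b ** y).
  exact/existsNP.
pose w := z ** hcomp 0 (e ** (b ** y)).
have Nw : N w by apply: (NM); apply: (Nh); apply: (NM); apply: (NM).
have we : w ** e = e.
  by rewrite /w -gmulA -(hcompMr _ _ e0) addr0.
have Ne : N e.
  rewrite -(subKr w e); apply: subspaceB => //; apply: MN; apply: kerM.
  by rewrite gmulBl we ee subrr.
rewrite -(subrK (a ** e) a); apply: subspaceD => //; last exact: NM.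
by apply: MN; apply: kerM; rewrite gmulBl -gmulA ee subrr.
Qed.

(** If [a b = e_i] with [a] in [e_i A e_j], then [b a = e_j]; for distinct [i]
    and [j] this would put [e_j] in the Jacobson radical. *)
Lemma weakly_basic_basic (I : choiceType) (e : I -> A) :
  weakly_basic_family e -> basic_family e.
Proof.
move=> [[e0 ee orth [_ _ decr] [_ _ decl]] _ loc basic].
have ie i : homog_idem (e i) by split; [case: (e0 i)|].
have li i : local_idem (e i).
  by apply: local_subalgebra_idem => //; case: (e0 i).
split=> // [x|x|i j g h a b ag bh ab].
- have [f [[fe ffin xf] _]] := decr x Logic.I.
  have [s [us s0 fs]] := fsum_seq ffin; exists s; rewrite {1}xf fs.
  apply: eq_big_seq => i si; rewrite xf fs linear_sumr (bigD1_seq i) //=.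
  rewrite big1 ?addr0 => [|j ji]; first by have [b _ <-] := fe i; rewrite gmulA ee.
  by have [b _ <-] := fe j; rewrite gmulA orth 1?eq_sym // gmul0l.
- have [f [[fe ffin xf] _]] := decl x Logic.I.
  have [s [us s0 fs]] := fsum_seq ffin; exists s; rewrite {1}xf fs.
  apply: eq_big_seq => i si; rewrite xf fs linear_sumlz (bigD1_seq i) //=.
  rewrite big1 ?addr0 => [|j ji]; first by have [b _ <-] := fe i; rewrite -gmulA ee.
  by have [b _ <-] := fe j; rewrite -gmulA orth // gmul0r.
- apply: contrapT => /eqP ij.
  have [_ ba] := local_swap (li i) (li j) ag bh ab.
  have Ja : graded_jacobson A a.
    by apply: (basic _ _ ij); exists a => //; have [_ -> ->] := ag.
  apply: (corner_nonunit_idem (li j)); rewrite -{2}ba.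
  exact: jacobson_corner_nonunit.
Qed.

End Families.

Section Radical.
Context (K : fieldType) (H : zmodType) (A : gradedAlgebra K H).
Context (I : choiceType) (e : I -> A).
Implicit Types (a b c x y z : A) (g h k : H) (i j l : I).

(** The graded Jacobson radical, described by its traces on the corners; the
    two-sided multiples make it visibly a two-sided ideal. *)
Definition corner_radical : set A :=
  [set x | forall i a b, corner_nonunit (e i) (a ** x ** b)].

Hypothesis fam : basic_family e.

Let loc i : local_idem (e i). Proof. by case: fam. Qed.
Let ie i : homog_idem (e i). Proof. by case: (loc i). Qed.
Let sU i : subspace (corner_nonunit (e i)).
Proof. exact: corner_nonunit_subspace. Qed.

Lemma left_decomposition (N : set A) x : subspace N ->
  (forall i h, N (e i ** hcomp h x)) -> N x.
Proof.
move=> sN Nx; apply: subspace_hcomp => // h.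
by have [_ /(_ (hcomp h x))[s ->] _ _] := fam; apply: subspace_sum.
Qed.

Lemma right_eq0 x : (forall j, x ** e j = 0) -> x = 0.
Proof.
by move=> x0; have [_ _ /(_ x)[s ->] _] := fam; rewrite big1.
Qed.

Lemma left_eq0 x : (forall i, e i ** x = 0) -> x = 0.
Proof.
by move=> x0; have [_ /(_ x)[s ->] _ _] := fam; rewrite big1.
Qed.

Lemma radical_subspace : subspace corner_radical.
Proof.
split=> [i a b|c u v Ju Jv i a b]; first by rewrite gmul0r gmul0l; apply: (sU i).1.
by rewrite gmulDr gmulZr gmulDl gmulZl; apply: (sU i).2.
Qed.

Lemma radicalMl a x : corner_radical x -> corner_radical (a ** x).
Proof. by move=> Jx i b c; rewrite gmulA; apply: Jx. Qed.

Lemma radicalMr a x : corner_radical x -> corner_radical (x ** a).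
Proof. by move=> Jx i b c; rewrite gmulA -gmulA; apply: Jx. Qed.

Lemma radical_homog x :
  (forall i g h a b, gcomp A g a -> gcomp A h b ->
    corner_nonunit (e i) (a ** x ** b)) -> corner_radical x.
Proof.
move=> Jx i; apply: homog_ind => [b|a a' na na' b|g a ag].
- by rewrite !gmul0l; apply: (sU i).1.
- by rewrite !gmulDl; apply: subspaceD.
apply: homog_ind => [|b b' nb nb'|h b bh].
- by rewrite gmul0r; apply: (sU i).1.
- by rewrite gmulDr; apply: subspaceD.
- exact: Jx ag bh.
Qed.

Lemma radical_hcomp h x : corner_radical x -> corner_radical (hcomp h x).
Proof.
move=> Jx; apply: radical_homog => i g k a b ag bk.
by rewrite -(hcompMl _ _ ag) -(hcompMr _ _ bk); apply: corner_nonunit_hcomp.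
Qed.

Lemma radical_nonunit i x : corner_radical x -> corner_nonunit (e i) x.
Proof.
move=> /(_ i (e i) (e i)); have [_ ee] := ie i; rewrite /corner_nonunit /=.
by rewrite !gmulA ee -!gmulA ee.
Qed.

Lemma unit_notin_radical i h a : corner_unit (e i) h a -> ~ corner_radical a.
Proof.
move=> [b [_ ba _]] Ja; apply: (corner_nonunit_idem (loc i)).
by rewrite -{2}ba; apply: radical_nonunit; apply: radicalMl.
Qed.

(** An element outside the radical satisfies some [p a q = e_l] with [p] and [q]
    homogeneous, and the last clause of [basic_family] forces [i = l = j]. *)
Lemma radical_or_unit i j h a : corner (e i) h (e j) a ->
  corner_radical a \/ i = j /\ corner_unit (e i) h a.
Proof.
move=> ah; have [Ja|nJa] := pselect (corner_radical a); [by left|right].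
have [l [g [k [p [q [pg qk nu]]]]]] : exists l g k p q, [/\ gcomp A g p, gcomp A k q
    & ~ corner_nonunit (e l) (p ** a ** q)].
  apply: contrapT => no; apply: nJa; apply: radical_homog => l g k p q pg qk.
  by apply: contrapT => nu; apply: no; exists l, g, k, p, q.
have cp := corner_sandwich (ie l) (ie i) pg.
have cq := corner_sandwich (ie j) (ie l) qk.
set p' := e l ** p ** e i in cp; set q' := e j ** q ** e l in cq.
have cpaq := cornerM (cornerM cp ah) cq.
have [_ ea ae] := ah.
have paq : e l ** (p ** a ** q) ** e l = p' ** a ** q'.
  by rewrite /p' /q' !gmulA -(gmulA _ (e i)) ea -(gmulA _ a (e j)) ae.
have [deg _ _] := cpaq.
move/contrapT: nu; rewrite paq (hcomp_homog 0 deg); case: eqP => [deg0|_] [z [cz zu _]]; last first.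
  by case: (loc l) => _ /eqP + _; rewrite -zu gmul0r.
rewrite oppr0 in cz; have [_ _ _ basic] := fam.
have czp := cornerM cz cp.
have zpaq : z ** p' ** a ** q' = e l by rewrite -!gmulA !gmulA in zu *.
have li : l = i.
  by apply: (basic _ _ _ _ _ _ czp (cornerM ah cq)); rewrite gmulA.
have lj : l = j by apply: (basic _ _ _ _ _ _ (cornerM czp ah) cq).
move: ah czp cq zpaq; rewrite -li -lj => ah czp cq zpaq; split=> //.
exact: (local_factor_unit (loc l) czp ah cq zpaq).
Qed.

End Radical.

(** * The graded socles as annihilators of the radical *)

Section Socle.
Context (K : fieldType) (H : zmodType) (A : gradedAlgebra K H).
Context (I : choiceType) (e : I -> A) (fam : basic_family e).
Implicit Types (a b c x y z : A) (g h k : H) (i j l : I).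

Let loc i : local_idem (e i). Proof. by case: fam. Qed.
Let ie i : homog_idem (e i). Proof. by case: (loc i). Qed.

Lemma left_annihilator_subspace x : subspace [set a | a ** x = 0].
Proof.
split=> [|c u v /= ux vx]; first exact: gmul0l.
by rewrite gmulDl gmulZl ux vx scaler0 addr0.
Qed.

Lemma right_annihilator_subspace a : subspace [set x | a ** x = 0].
Proof.
split=> [|c u v /= au av]; first exact: gmul0r.
by rewrite gmulDr gmulZr au av scaler0 addr0.
Qed.

Lemma principal_graded_left_ideal h y :
  gcomp A h y -> graded_left_ideal A [set a ** y | a in setT].
Proof.
move=> yh; apply/graded_submoduleP; split.
- split; first by exists 0; rewrite ?gmul0l.
  move=> c _ _ [a _ <-] [b _ <-]; exists (c *: a + b) => //.
  by rewrite gmulDl gmulZl.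
- by move=> a _ [b _ <-]; exists (a ** b); rewrite ?gmulA.
- move=> k _ [a _ <-]; exists (hcomp (k - h) a) => //.
  by rewrite -(hcompMr _ _ yh) subrK.
Qed.

(** A nonzero submodule of [A y] contains some nonzero [a y] with [a] in a
    corner; as [a] is not in the radical, it is invertible and gives back
    [y]. *)
Lemma annihilated_simple i h y :
  gcomp A h y -> e i ** y = y -> y != 0 ->
  (forall a, corner_radical e a -> a ** y = 0) ->
  graded_simple_submodule (gcomp A) (fun a x => a ** x) [set a ** y | a in setT].
Proof.
move=> yh ey yn0 Jy; split; first exact: principal_graded_left_ideal yh.
  move=> S0; have : [set a ** y | a in setT] y by exists (e i).
  by rewrite S0 /= => y0; rewrite y0 eqxx in yn0.
move=> N /graded_submoduleP[sN NM Nh] NS.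
have [N0|[z [Nz zn0]]] : N = [set 0] \/ exists z, N z /\ z <> 0.
- have [[z [Nz zn0]]|no] := pselect (exists z, N z /\ z <> 0); [by right; exists z|left].
  apply/seteqP; split=> [z Nz|_ ->]; last exact: sN.1.
  by apply: contrapT => zn0; apply: no; exists z.
- by left.
right; apply/seteqP; split=> // _ [a _ <-]; apply: (NM).
have [l [k nz]] : exists l k, e l ** hcomp k z <> 0.
  apply: contrapT => no; apply: zn0.
  apply: (left_decomposition fam (N := [set 0])) => [|l k].
    by split=> // c u v -> ->; rewrite /= scaler0 addr0.
  by apply: contrapT => nz; apply: no; exists l, k.
have [b _ zE] := NS _ Nz.
set w := e l ** hcomp k z in nz.
have Nw : N w by apply: (NM); apply: (Nh).
pose b' := e l ** hcomp (k - h) b ** e i.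
have wE : w = b' ** y.
  by rewrite /w /b' -zE -gmulA ey -gmulA -(hcompMr _ _ yh) subrK.
have cb : corner (e l) (k - h) (e i) b' by apply: corner_sandwich (hcomp_in _ _).
case: (radical_or_unit fam cb) => [/Jy|[li [c [_ cb' _]]]].
  by rewrite -wE.
have -> : y = c ** w by rewrite wE gmulA cb' li ey.
exact: NM.
Qed.

(** The graded Nakayama lemma: if [b y] is not [0] for a homogeneous [b] in the
    radical, then [y] is a multiple [c b y], where [e_i - c b] is invertible. *)
Lemma radical_kills_simple (S : set A) a x :
  graded_simple_submodule (gcomp A) (fun a x => a ** x) S ->
  corner_radical e a -> S x -> a ** x = 0.
Proof.
move=> [/graded_submoduleP[sS SM Sh] _ simple] Ja Sx.
suff key i l g h b y : corner (e l) g (e i) b -> corner_radical e b ->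
    gcomp A h y -> e i ** y = y -> S y -> b ** y = 0.
  apply: (left_decomposition fam (right_annihilator_subspace a)) => i h.
  apply: (left_decomposition fam (left_annihilator_subspace _)) => l g.
  have [h0 ei] := ie i; have ih := gcompM h0 (hcomp_in h x).
  rewrite /= -{1}ei -!gmulA gmulA (gmulA (e l ** _)).
  apply: (key i l g _ _ _ _ _ ih); first by apply: corner_sandwich (hcomp_in _ _).
  - by apply: radicalMr; apply: radicalMl; apply: radical_hcomp.
  - by rewrite gmulA ei.
  - by apply: (SM); apply: (Sh).
move=> bg Jb yh ey Sy; apply: contrapT => by0.
have [bdeg lb bi] := bg; have byh := gcompM bdeg yh.
have SE : [set c ** (b ** y) | c in setT] = S.
  case: (simple _ (principal_graded_left_ideal byh)) => [_ [c _ <-]|S0|//].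
    by apply: (SM); apply: (SM).
  have : [set c ** (b ** y) | c in setT] (b ** y).
    by exists (e l); rewrite ?gmulA ?lb.
  by rewrite S0.
move: (Sy); rewrite -SE => -[c _ cby].
pose c' := e i ** hcomp (h - (g + h)) c ** e l.
have cc : corner (e i) (h - (g + h)) (e l) c'.
  by apply: corner_sandwich (hcomp_in _ _).
have c'by : c' ** b ** y = y.
  rewrite /c' -!gmulA (gmulA (e l)) lb -(hcompMr _ _ byh) subrK cby.
  by rewrite (hcomp_id yh).
have cb := cornerM cc bg; rewrite opprD addrCA subrr addr0 addNr in cb.
have [_ _ /(_ _ cb)[u|[z [_ zu _]]]] := loc i.
  exact: (unit_notin_radical fam u (radicalMl Jb)).
apply: by0; have -> : y = 0; last exact: gmul0r.
by rewrite -ey -zu -gmulA gmulBl ey c'by subrr gmul0r.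
Qed.

Theorem left_graded_socleE :
  left_graded_socle A = [set x | forall a, corner_radical e a -> a ** x = 0].
Proof.
apply/seteqP; split=> [x [s [sP ->]] a Ja|x Jx].
  rewrite linear_sumr big_seq big1 // => y /sP[S simS Sy].
  exact: radical_kills_simple simS Ja Sy.
have soc0 : left_graded_socle A 0 by exists [::]; rewrite big_nil.
have socD y z : left_graded_socle A y -> left_graded_socle A z ->
    left_graded_socle A (y + z).
  move=> [s [sP ->]] [t [tP ->]]; exists (s ++ t); rewrite big_cat; split=> // w.
  by rewrite mem_cat => /orP[/sP|/tP].
have [s [_ _ ->]] := hcomp_seq x; elim/big_ind: _ => // h _.
have [_ /(_ (hcomp h x))[t ->] _ _] := fam; elim/big_ind: _ => // i _.
set y := e i ** hcomp h x; have [->|yn0] := eqVneq y 0; first exact: soc0.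
have yh : gcomp A h y.
  by have := gcompM (ie i).1 (hcomp_in h x); rewrite add0r.
have ey : e i ** y = y by rewrite /y gmulA (ie i).2.
exists [:: y]; rewrite big_seq1; split=> // z; rewrite inE => /eqP ->.
exists [set a ** y | a in setT]; last by exists (e i).
apply: annihilated_simple yh ey yn0 _ => a Ja.
have Ja' : corner_radical e (a ** e i) by apply: radicalMr.
rewrite /y gmulA.
apply: (left_decomposition fam (left_annihilator_subspace _)) => l g /=.
rewrite -gmulA -(hcompMl _ _ (hcomp_in g _)) Jx ?hcomp0 ?gmul0r //.
exact: radical_hcomp.
Qed.

End Socle.

(** * The opposite algebra *)

Section Opposite.
Context (K : fieldType) (H : zmodType) (A : gradedAlgebra K H).

Definition opposite_mul (a b : A) : A := b ** a.

Lemma opposite_mul_bilinear :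
  bilinear_for *:%R *:%R (opposite_mul : A -> A -> A).
Proof. by split=> u c v w; [apply: linearPr|apply: linearPl]. Qed.

HB.instance Definition _ := bilinear_isBilinear.Build K A A A *:%R *:%R
  opposite_mul opposite_mul_bilinear.

Lemma opposite_mulA : associative opposite_mul.
Proof. by move=> a b c; rewrite /opposite_mul gmulA. Qed.

Lemma opposite_compM (h k : H) (a b : A) :
  gcomp A h a -> gcomp A k b -> gcomp A (h + k) (opposite_mul a b).
Proof. by move=> ah bk; rewrite addrC; apply: gcompM. Qed.

Definition opposite : gradedAlgebra K H :=
  @GradedAlgebra K H A opposite_mul opposite_mulA (gcomp A) (gcomp_direct A)
    opposite_compM.

Lemma oppositeE (a b : A) : (a : opposite) ** (b : opposite) = b ** a.
Proof. by []. Qed.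

Lemma hcomp_opposite h (x : A) : hcomp h (x : opposite) = hcomp h x.
Proof.
apply: (hcomp_unique (A := opposite) (f := fun h => hcomp h x)).
- by move=> k; apply: hcomp_in.
- exact: hcomp_fin.
- exact: (@hcomp_fsum _ _ A).
Qed.

Lemma corner_opposite (x y : A) h :
  corner (A := opposite) x h y = corner y h x.
Proof. by apply/seteqP; split=> a [ah xa ay]; split. Qed.

Lemma corner_unit_opposite (x a : A) h :
  corner_unit (A := opposite) x h a = corner_unit x h a.
Proof.
by apply/propext; split=> -[b [bh ba ab]]; exists b; split=> //;
  [rewrite -corner_opposite|rewrite corner_opposite].
Qed.

Lemma corner_nonunit_opposite (x : A) :
  corner_nonunit (A := opposite) x = corner_nonunit x.
Proof.
apply/funext => y; rewrite /corner_nonunit /= corner_unit_opposite.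
by rewrite hcomp_opposite !oppositeE gmulA.
Qed.

Lemma local_idem_opposite (x : A) :
  local_idem x -> local_idem (A := opposite) x.
Proof.
move=> [ix xn0 loc]; split=> // a; rewrite corner_opposite.
by rewrite !corner_unit_opposite; apply: loc.
Qed.

Lemma basic_family_opposite (I : choiceType) (e : I -> A) :
  basic_family e -> basic_family (A := opposite) e.
Proof.
move=> [loc decl decr basic]; split=> //.
  by move=> i; apply: local_idem_opposite.
move=> i j g h a b; rewrite !corner_opposite => ag bh ab.
exact: (basic i j h g b a).
Qed.

Lemma corner_radical_opposite (I : choiceType) (e : I -> A) :
  corner_radical (A := opposite) e = corner_radical e.
Proof.
by apply/seteqP; split=> x Jx i a b; have := Jx i b a;
  rewrite corner_nonunit_opposite !oppositeE gmulA.
Qed.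

Lemma right_graded_socleE (I : choiceType) (e : I -> A) : basic_family e ->
  right_graded_socle A = [set x | forall a, corner_radical e a -> x ** a = 0].
Proof.
move=> /basic_family_opposite/left_graded_socleE.
by rewrite corner_radical_opposite.
Qed.

Section Form.
Context (B : {biscalar A}).

Definition opposite_form (a b : opposite) : K := B b a.

Lemma opposite_form_bilinear :
  bilinear_for *%R *%R (opposite_form : opposite -> opposite -> K).
Proof. by split=> u c v w; [apply: linearPr|apply: linearPl]. Qed.

HB.instance Definition _ := bilinear_isBilinear.Build K opposite opposite K
  *%R *%R opposite_form opposite_form_bilinear.

Lemma peirce_opposite (x y : A) : peirce (A := opposite) x y = peirce y x.
Proof. by apply/seteqP; split=> _ [b _ <-]; exists b; rewrite ?oppositeE ?gmulA. Qed.

Lemma Nakayama_form_opposite (I : choiceType) (e : I -> A) nu nu' hdeg :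
  graded_Nakayama_form e B nu hdeg -> cancel nu nu' -> cancel nu' nu ->
  graded_Nakayama_form (A := opposite) e opposite_form nu' (hdeg \o nu').
Proof.
move=> [BA nuP _ form] nuK nu'K; split.
- by move=> a b c; apply: (esym (BA c b a)).
- move=> i; have [[a [b ab]] _] := nuP (nu' i).
  split; first by exists b, a; move: ab; rewrite nu'K.
  move=> j [b' [a' ab']]; have [_ /(_ i) <-//] := nuP j.
  by exists a', b'.
- by exists nu.
- move=> i j; have [deg nondeg] := form (nu' i) j.
  rewrite nu'K in deg nondeg; rewrite !peirce_opposite; split.
    by move=> h k v w vh wk vw; rewrite addrC; apply: deg vw.
  by case: nondeg => n1 n2; split.
Qed.

End Form.

End Opposite.

(** * Nakayama forms and the socle *)

Section Forms.
Context (K : fieldType) (H : zmodType) (A : gradedAlgebra K H).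
Context (I : choiceType) (e : I -> A) (fam : basic_family e).
Context (B : {biscalar A}) (nu : I -> I) (hdeg : I -> H).
Hypothesis nak : graded_Nakayama_form e B nu hdeg.
Implicit Types (a b c u v w x y z : A) (g h k : H) (i j l : I).

Let ie i : homog_idem (e i). Proof. by case: fam => /(_ i)[]. Qed.
Let ee i : e i ** e i = e i. Proof. exact: (ie i).2. Qed.
Let BA a b c : B (a ** b) c = B a (b ** c). Proof. by case: nak. Qed.

Lemma peirceP i j v : peirce (e i) (e j) v <-> e i ** v = v /\ v ** e j = v.
Proof.
split=> [[a _ <-]|[iv vj]]; first by rewrite !gmulA ee -(gmulA _ (e j)) ee.
by exists v => //; rewrite iv vj.
Qed.

Lemma peirce_subspace i j : subspace (peirce (e i) (e j)).
Proof.
split=> [|c u v /peirceP[iu uj] /peirceP[iv vj]]; apply/peirceP.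
  by rewrite gmul0r gmul0l.
by rewrite gmulDr gmulDl gmulZr gmulZl iu uj iv vj.
Qed.

Lemma graded_dual0 (V : set A) : graded_dual V (fun=> 0).
Proof.
split=> [c u v _ _|]; first by rewrite mulr0 addr0.
apply: (@sub_finite_set _ _ set0); last exact: finite_set0.
by move=> h [v _]; rewrite eqxx.
Qed.

Lemma form_left_eq0 i j x : peirce (e i) (e j) x ->
  (forall w, peirce (e j) (e (nu i)) w -> B x w = 0) -> x = 0.
Proof.
have [_ _ _ /(_ i j)[_ [_ /(_ _ (graded_dual0 _))[y [_ yU]]]]] := nak.
move=> xP x0; rewrite -(yU x) //; apply: yU; split=> [|w _].
  exact: (peirce_subspace i j).1.
by rewrite linear0l.
Qed.

Lemma form_right_eq0 i j x : peirce (e j) (e (nu i)) x ->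
  (forall v, peirce (e i) (e j) v -> B v x = 0) -> x = 0.
Proof.
have [_ _ _ /(_ i j)[_ [/(_ _ (graded_dual0 _))[y [_ yU]] _]]] := nak.
move=> xP x0; rewrite -(yU x) //; apply: yU; split=> [|w _].
  exact: (peirce_subspace j (nu i)).1.
by rewrite linear0r.
Qed.

Lemma form_degree i j h k v w :
  peirce (e i) (e j) v -> gcomp A h v -> peirce (e j) (e (nu i)) w ->
  gcomp A k w -> h + k != hdeg i -> B v w = 0.
Proof.
move=> vP vh wP wk; apply: contra_neq_eq => Bvw.
by have [_ _ _ /(_ i j)[deg _]] := nak; apply: (deg h k v w).
Qed.

Lemma peirce_hcomp i j h v :
  peirce (e i) (e j) v -> peirce (e i) (e j) (hcomp h v).
Proof.
move=> /peirceP[iv vj]; apply/peirceP.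
have [i0 _] := ie i; have [j0 _] := ie j.
split; first by rewrite -{2}iv -(hcompMl _ _ i0) add0r.
by rewrite -{2}vj -(hcompMr _ _ j0) addr0.
Qed.

Lemma form_hcomp i j h k v w :
  peirce (e i) (e j) v -> peirce (e j) (e (nu i)) w -> gcomp A k w ->
  h + k = hdeg i -> B (hcomp h v) w = B v w.
Proof.
move=> vP wP wk hk; apply/esym/eqP; rewrite -subr_eq0 -linearBl; apply/eqP.
have sN : subspace [set u | B u w = 0].
  split=> [|c x y /= xw yw]; first exact: linear0l.
  by rewrite linearPl xw yw mulr0 addr0.
apply: (subspace_hcomp sN) => g /=; rewrite hcompB (hcomp_homog g (hcomp_in h v)).
case: eqP => [->|gh]; first by rewrite subrr linear0l.
rewrite subr0; apply: form_degree (peirce_hcomp _ vP) (hcomp_in _ _) wP wk _.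
by rewrite -hk (inj_eq (addIr k)); apply/eqP.
Qed.

(** The functional [v |-> B (e i) (v ** w)] is represented by some [a], and
    associativity of the form turns this representation into an adjunction: [a]
    and [w] correspond to each other under the Nakayama automorphism. *)
Lemma form_adjoint i h w : corner (e (nu i)) h (e (nu i)) w ->
  exists2 a, corner (e i) h (e i) a
    & forall x v, e i ** x = x -> v ** e (nu i) = v ->
        B (a ** x) v = B x (v ** w).
Proof.
move=> [wh nw wn]; have ei : peirce (e i) (e i) (e i) by apply/peirceP.
have [i0 _] := ie i.
have vwP v : peirce (e i) (e (nu i)) v -> peirce (e i) (e (nu i)) (v ** w).
  by move=> /peirceP[iv vn]; apply/peirceP; rewrite gmulA iv -gmulA wn.
have Bdeg v k : peirce (e i) (e (nu i)) v -> gcomp A k v -> k + h != hdeg i ->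
    B (e i) (v ** w) = 0.
  move=> vP vk kh; apply: form_degree ei i0 (vwP _ vP) (gcompM vk wh) _.
  by rewrite add0r.
have dual : graded_dual (peirce (e i) (e (nu i))) (fun v => B (e i) (v ** w)).
  split=> [c u v _ _|]; first by rewrite gmulDl gmulZl linearPr.
  apply: (@sub_finite_set _ _ [set hdeg i - h]) => // k [v [vP vk]] Bn0 /=.
  apply/eqP; rewrite -subr_eq opprK; apply: contraNT Bn0 => kh.
  by rewrite (Bdeg v k).
have [_ _ _ /(_ i i)[_ [_ /(_ _ dual)[a0 [[a0P Ba0] _]]]]] := nak.
exists (hcomp h a0).
  by have [ia <-] := (peirceP i i a0).1 a0P; rewrite -{1}ia; apply: corner_hcomp.
have key v : peirce (e i) (e (nu i)) v -> B (hcomp h a0) v = B (e i) (v ** w).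
  move=> vP.
  have sN : subspace [set u | B (hcomp h a0) u = B (e i) (u ** w)].
    split=> [|c x y /= xw yw]; first by rewrite /= gmul0l !linear0r.
    by rewrite gmulDl gmulZl !linearPr xw yw.
  apply: (subspace_hcomp sN) => k /=.
  have kP := peirce_hcomp k vP; have kk := hcomp_in k v.
  have [hk|hk] := eqVneq (h + k) (hdeg i).
    by rewrite (form_hcomp a0P kP kk hk) Ba0.
  rewrite (form_degree (peirce_hcomp h a0P) (hcomp_in h a0) kP kk hk).
  by rewrite (Bdeg _ k) // addrC.
move=> x v ix vn; rewrite BA key; last by apply/peirceP; rewrite gmulA ix -gmulA vn.
by rewrite -gmulA -BA ix.
Qed.

Lemma peirce_radical i j v :
  i != j -> peirce (e i) (e j) v -> corner_radical e v.
Proof.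
move=> ij vP; apply: (subspace_hcomp (radical_subspace fam)) => h.
have [iv vj] := (peirceP _ _ _).1 (peirce_hcomp h vP).
have ch : corner (e i) h (e j) (hcomp h v) by split=> //; apply: hcomp_in.
by case: (radical_or_unit fam ch) => // -[E]; rewrite E eqxx in ij.
Qed.

(** Write [j = nu k]. The pairing with [v] in [e_k A e_i] moves [v] next to [x],
    and [v x = 0] because [v] is in the radical when [k] is not [i]. *)
Lemma annihilated_support i j x :
  bijective nu -> (forall a, corner_radical e a -> a ** x = 0) ->
  j != nu i -> e i ** x ** e j = 0.
Proof.
move=> [nu' nuK nu'K] Jx; rewrite -(nu'K j) (can_eq nuK); set k := nu' j => ki.
apply: (@form_right_eq0 k i); first by exists x.
move=> v vP; have [kv vi] := (peirceP _ _ _).1 vP.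
have Jv : corner_radical e v by apply: peirce_radical vP.
by rewrite -kv BA !gmulA vi (Jx _ Jv) gmul0l linear0r.
Qed.

End Forms.

Section NakayamaSocle.
Context (K : fieldType) (H : zmodType) (A : gradedAlgebra K H).
Context (I : choiceType) (e : I -> A).
Implicit Types (a b c u v w x y z : A) (g h k : H) (i j l : I).

(** The adjunction in the other direction is [form_adjoint] for the form
    [B b a] on the opposite algebra. *)
Lemma form_adjoint_rev (B : {biscalar A}) (nu : I -> I) hdeg i h a :
  basic_family e -> graded_Nakayama_form e B nu hdeg ->
  corner (e i) h (e i) a ->
  exists2 w, corner (e (nu i)) h (e (nu i)) w
    & forall x v, e i ** x = x -> v ** e (nu i) = v ->
        B (a ** x) v = B x (v ** w).
Proof.
move=> fam nak; have [_ _ [nu' nuK nu'K] _] := nak => ai.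
have nak' := Nakayama_form_opposite nak nuK nu'K.
have ai' : corner (A := opposite A) (e (nu' (nu i))) h (e (nu' (nu i))) a.
  by rewrite nuK corner_opposite.
have [w wi adj] := form_adjoint (basic_family_opposite fam) nak' ai'.
rewrite corner_opposite in wi; exists w => // x v ix vn.
by apply/esym/(adj v x) => //; rewrite nuK.
Qed.

Section WithForm.
Hypothesis fam : basic_family e.
Context (B : {biscalar A}) (nu : I -> I) (hdeg : I -> H).
Hypothesis nak : graded_Nakayama_form e B nu hdeg.

Let ie i : homog_idem (e i). Proof. by case: fam => /(_ i)[]. Qed.
Let ee i : e i ** e i = e i. Proof. exact: (ie i).2. Qed.
Let BA a b c : B (a ** b) c = B a (b ** c). Proof. by case: nak. Qed.

(** Adjoints of units are units: both directions of the adjunction compose to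
    the identity. *)
Lemma adjoint_unit i h a w :
  corner_unit (e i) h a -> corner (e (nu i)) h (e (nu i)) w ->
  (forall x v, e i ** x = x -> v ** e (nu i) = v ->
     B (a ** x) v = B x (v ** w)) ->
  ~ corner_radical e w.
Proof.
move=> [b [bi _ ab]] [_ nw wn] adj Jw.
have [w' [_ nw' wn'] adj'] := form_adjoint_rev fam nak bi.
suff ww : w ** w' = e (nu i).
  have [/(_ (nu i)) loc _ _ _] := fam.
  apply: (unit_notin_radical fam (corner_unit_idem loc)).
  by rewrite -ww; apply: radicalMr.
apply/eqP; rewrite -subr_eq0; apply/eqP; set n := e (nu i) in nw wn nw' wn' *.
have nn : n ** n = n by apply: ee.
apply: (form_right_eq0 fam nak (i := i) (j := nu i)).
  apply/(peirceP fam).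
  by rewrite gmulBr gmulBl !gmulA nw -gmulA wn' nn.
move=> x /(peirceP fam)[ix xn].
have bx : e i ** (b ** x) = b ** x by have [_ eb _] := bi; rewrite gmulA eb.
by rewrite linearBr -(adj' _ _ ix wn) -nw -(adj _ _ bx nn) gmulA ab ix subrr.
Qed.

(** For [y] in [e i A e (nu i)], the identity [B (a ** y) 1 = B y w], with [w]
    adjoint to [a], trades annihilation on the left for annihilation on the
    right. *)
Lemma left_annihilated_right x :
  (forall a, corner_radical e a -> a ** x = 0) ->
  forall w, corner_radical e w -> x ** w = 0.
Proof.
move=> Jx w Jw; have [_ _ bij_nu _] := nak; have [nu' nuK nu'K] := bij_nu.
apply: (left_eq0 fam) => i; apply: (right_eq0 fam) => j.
rewrite -(nu'K j); set k := nu' j.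
apply: (form_right_eq0 fam nak (i := k) (j := i)).
  by exists (x ** w).
move=> v vP; have [kv vi] := (peirceP fam _ _ _).1 vP.
have -> : B v (e i ** (x ** w) ** e (nu k)) = B (v ** x) (w ** e (nu k)).
  by rewrite -!gmulA -BA vi BA.
have [ki|/negbNE/eqP ki] := boolP (k != i).
  have Jv : corner_radical e v by apply: (peirce_radical fam) vP.
  by rewrite (Jx _ Jv) linear0l.
rewrite ki in kv *; set y := v ** x; set n := e (nu i).
have iy : e i ** y = y by rewrite gmulA kv.
have Jy a : corner_radical e a -> a ** y = 0.
  by move=> Ja; rewrite gmulA Jx //; apply: radicalMr.
have yn : y ** n = y.
  have sN : subspace [set z | z ** n = z].
    split=> [|c z z' /= zn z'n]; first exact: gmul0l.
    by rewrite gmulDl gmulZl zn z'n.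
  have [_ _ /(_ y)[s ys] _] := fam.
  suff : [set z | z ** n = z] y by [].
  rewrite ys; apply: subspace_sum => // l /=.
  have [->|li] := eqVneq l (nu i); first by rewrite -gmulA ee.
  by rewrite -iy (annihilated_support fam nak bij_nu Jy li) gmul0l.
rewrite -yn BA gmulA.
have sN : subspace [set z | B y z = 0].
  split=> [|c z z' /= yz yz']; first exact: linear0r.
  by rewrite linearPr yz yz' mulr0 addr0.
apply: (subspace_hcomp sN) => h /=.
have cw : corner n h n (hcomp h (n ** w ** n)) by apply: corner_hcomp (ie _).
have Jwh : corner_radical e (hcomp h (n ** w ** n)).
  by apply: radical_hcomp => //; apply: radicalMr; apply: radicalMl.
set wh := hcomp h _ in cw Jwh *.
have [_ nwh _] := cw.
have [a ai adj] := form_adjoint fam nak cw.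
rewrite -nwh -adj //; last exact: ee.
case: (radical_or_unit fam ai) => [/Jy ->|[_ ua]]; first by rewrite linear0l.
by case: (adjoint_unit ua cw adj).
Qed.

(** The functional on the corner of [e (nu i)] that kills its maximal ideal and
    is [1] at the idempotent is represented by a socle element. *)
Lemma right_annihilated_nonzero i :
  exists x, [/\ forall a, corner_radical e a -> x ** a = 0, e i ** x = x,
    x ** e (nu i) = x & x != 0].
Proof.
have [/(_ (nu i)) loc _ _ _] := fam; set n := e (nu i) in loc *.
have [phi [phi_lin phi0 phi1]] := separating_functional
  (corner_nonunit_subspace loc) (corner_nonunit_idem loc).
have dual : graded_dual (peirce n n) phi.
  split=> [c u v _ _|]; first exact: phi_lin.
  apply: (@sub_finite_set _ _ [set 0]) => // h [v [/(peirceP fam)[nv vn] vh]] /=.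
  apply: contra_neqP => /eqP h0; apply: (phi0); rewrite /corner_nonunit /= nv vn.
  rewrite (hcomp_homog 0 vh) eq_sym (negbTE h0) => -[z [_ z0 _]].
  by case: loc => _ /eqP + _; rewrite -z0 gmul0r.
have [_ _ _ /(_ i (nu i))[_ [_ /(_ _ dual)[x [[xP xphi] _]]]]] := nak.
have [ix xn] := (peirceP fam _ _ _).1 xP.
exists x; split=> //; last first.
  apply: contraTneq (oner_neq0 K) => x0; rewrite -phi1 -xphi.
    by rewrite x0 linear0l eqxx.
  by apply/(peirceP fam); rewrite ee.
move=> w Jw; apply: (right_eq0 fam) => l.
apply: (form_left_eq0 fam nak (i := i) (j := l)).
  by exists (x ** w); rewrite // gmulA ix.
move=> u /(peirceP fam)[lu un].
rewrite !BA lu -xn BA xphi; last first.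
  by exists (w ** u); rewrite // -!gmulA un.
apply: (phi0); apply: (radical_nonunit fam).
by apply: radicalMl; apply: radicalMr.
Qed.

End WithForm.

End NakayamaSocle.

Section SocleEquality.
Context (K : fieldType) (H : zmodType) (A : gradedAlgebra K H).
Context (I : choiceType) (e : I -> A).

Lemma left_right_annihilated (B : {biscalar A}) nu hdeg :
  basic_family e -> graded_Nakayama_form e B nu hdeg ->
  [set x | forall a, corner_radical e a -> a ** x = 0] =
  [set x | forall a, corner_radical e a -> x ** a = 0].
Proof.
move=> fam nak; have [_ _ [nu' nuK nu'K] _] := nak.
have nak' := Nakayama_form_opposite nak nuK nu'K.
have := left_annihilated_right (basic_family_opposite fam) nak'.
rewrite corner_radical_opposite => right_left.
by apply/seteqP; split=> x; [apply: (left_annihilated_right fam nak)|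
  apply: right_left].
Qed.

Lemma graded_socles_eq (B : {biscalar A}) nu hdeg :
  basic_family e -> graded_Nakayama_form e B nu hdeg ->
  left_graded_socle A = right_graded_socle A.
Proof.
move=> fam nak; rewrite (left_graded_socleE fam) (right_graded_socleE fam).
exact: left_right_annihilated nak.
Qed.

Definition socle_permutation (nu : I -> I) : Prop :=
  forall i, unique (fun j => exists2 s, left_graded_socle A s
                                      & e i ** s ** e j != 0) (nu i).

Lemma Nakayama_socle_permutation (B : {biscalar A}) nu hdeg :
  basic_family e -> graded_Nakayama_form e B nu hdeg -> socle_permutation nu.
Proof.
move=> fam nak i; have [_ _ bij_nu _] := nak; split.
  have [x [xJ ix xn xn0]] := right_annihilated_nonzero fam nak i.
  exists x; last by rewrite ix xn.
  rewrite (left_graded_socleE fam).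
  by rewrite (left_right_annihilated fam nak).
move=> j [s]; rewrite (left_graded_socleE fam) => Js.
by apply: contraNeq => /eqP/nesym/eqP ji; apply/eqP;
  apply: (annihilated_support fam nak).
Qed.

End SocleEquality.

(** * Comparing two basic families *)

Section Transfer.
Context (K : fieldType) (H : zmodType) (A : gradedAlgebra K H).
Implicit Types (I J : choiceType) (a b s x y : A).

(** [A x] and [A y] are isomorphic graded left modules, through right
    multiplication by [a] and [b]. *)
Definition equivalent_idems x y : Prop :=
  exists a b, [/\ corner x 0 y a, corner y 0 x b, a ** b = x & b ** a = y].

Lemma equivalent_idems_sym x y : equivalent_idems x y -> equivalent_idems y x.
Proof. by move=> [a [b [ax bx ab ba]]]; exists b, a. Qed.

(** The Krull-Schmidt argument: [x] is the finite sum of the [x e_k x], so one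
    of them is invertible in the local corner of [x]. *)
Lemma equivalent_idem_exists J (e : J -> A) x :
  basic_family e -> local_idem x -> exists k, equivalent_idems x (e k).
Proof.
move=> [loce dec _ _] loc; have [ix xn0 _] := loc; have [x0 xx] := ix.
have [k] : exists k, ~ corner_nonunit x (e k ** x).
  apply: contrapT => no; apply: (corner_nonunit_idem loc).
  have [s xs] := dec x; rewrite {2}xs.
  apply: subspace_sum => [|k]; first exact: corner_nonunit_subspace.
  by apply: contrapT => nu; apply: no; exists k.
move=> /contrapT; have [ik _ _] := loce k; have [k0 kk] := ik.
have xk : gcomp A 0 (x ** e k) by have := gcompM x0 k0; rewrite addr0.
rewrite gmulA -gmulA xx hcomp_id; last first.
  by have := gcompM xk x0; rewrite addr0.
move=> [z [[z0 xz zx] zu _]]; rewrite oppr0 in z0.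
have za : corner x 0 (e k) (z ** e k).
  by have := gcompM z0 k0; rewrite addr0; split=> //; rewrite ?gmulA ?xz -?gmulA ?kk.
have kb : corner (e k) 0 x (e k ** x).
  by have := gcompM k0 x0; rewrite addr0; split=> //; rewrite ?gmulA ?kk -?gmulA ?xx.
have ab : z ** e k ** (e k ** x) = x.
  by rewrite -[RHS]zu !gmulA zx -(gmulA z) kk.
exists k, (z ** e k), (e k ** x); split=> //.
by have [] := local_swap loc (loce k) za kb ab.
Qed.

Lemma equivalent_idem_inj I (e : I -> A) i i' y : basic_family e ->
  equivalent_idems (e i) y -> equivalent_idems (e i') y -> i = i'.
Proof.
move=> [_ _ _ basic] [a [b [ai bi ab ba]]] [a' [b' [ai' bi' ab' ba']]].
apply: (basic _ _ _ _ _ _ (cornerM ai bi') (cornerM ai' bi)).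
by have [_ _ ay] := ai; rewrite gmulA -(gmulA a) ba' ay.
Qed.

(** [x s x'] and [y (b s a') y'] determine each other, since [a] and [b] are
    mutually inverse isomorphisms and so are [a'] and [b']. *)
Lemma socle_transfer (S : set A) x x' y y' :
  (forall a s b, S s -> S (a ** s ** b)) ->
  equivalent_idems x y -> equivalent_idems x' y' ->
  (exists2 s, S s & x ** s ** x' != 0) -> exists2 s, S s & y ** s ** y' != 0.
Proof.
move=> SM [a [b [[_ _ ay] _ ab _]]] [a' [b' [[_ _ ay'] _ ab' _]]] [s Ss xsx'].
exists (b ** s ** a'); first exact: SM.
apply: contraNneq xsx' => y0.
have : a ** (y ** (b ** s ** a') ** y') ** b' = x ** s ** x'.
  by rewrite !gmulA ay ab -(gmulA _ a' y') ay' -(gmulA _ a' b') ab'.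
by rewrite y0 gmul0r gmul0l => <-.
Qed.

Lemma left_graded_socle_ideal I (e : I -> A) a s b : basic_family e ->
  left_graded_socle A s -> left_graded_socle A (a ** s ** b).
Proof.
move=> fam; rewrite (left_graded_socleE fam) => Js c Jc.
by rewrite !gmulA Js ?gmul0l //; apply: radicalMr.
Qed.

Lemma socle_permutation_transfer I J (e : I -> A) (f : J -> A) (nu : J -> J) :
  basic_family e -> basic_family f -> bijective nu -> socle_permutation f nu ->
  exists2 nu' : I -> I, bijective nu' & socle_permutation e nu'.
Proof.
move=> fame famf [mu nuK muK] soc.
have /choice[sigma sigmaP] i : exists k, equivalent_idems (e i) (f k).
  apply: equivalent_idem_exists => //.
  by case: fame.
have /choice[tau tauP] k : exists i, equivalent_idems (f k) (e i).
  apply: equivalent_idem_exists => //.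
  by case: famf.
have sigmaK : cancel sigma tau.
  move=> i; apply: (equivalent_idem_inj fame (y := f (sigma i))) => //.
  exact: equivalent_idems_sym.
have tauK : cancel tau sigma.
  move=> k; apply: (equivalent_idem_inj famf (y := e (tau k))) => //.
  exact: equivalent_idems_sym.
have socM a s b := left_graded_socle_ideal a b fame (s := s).
exists (tau \o nu \o sigma).
  by exists (tau \o mu \o sigma) => i /=; rewrite tauK ?nuK ?muK sigmaK.
move=> i; have [exi uniqi] := soc (sigma i); split.
  by apply: socle_transfer exi => //; apply: equivalent_idems_sym.
move=> j exj; rewrite /= (uniqi (sigma j)) ?sigmaK //.
exact: socle_transfer exj.
Qed.

End Transfer.

Lemma weakly_basic_socle (K : fieldType) (H : zmodType) (A : gradedAlgebra K H)
    (I : choiceType) (e : I -> A) :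
  graded_pseudo_Frobenius A -> weakly_basic_family e ->
  left_graded_socle A = right_graded_socle A /\
  exists nu : I -> I,
    [/\ bijective nu,
        forall (B : {biscalar A}) (nu' : I -> I) (hdeg : I -> H),
          graded_Nakayama_form e B nu' hdeg -> nu' = nu
      & socle_permutation e nu].
Proof.
move=> [J [f [/weakly_basic_basic famf [B [nu [hdeg nak]]]]]].
move=> /weakly_basic_basic fame; split; first exact: graded_socles_eq famf nak.
have [_ _ bij_nu _] := nak.
have [nu' bij_nu' soc'] := socle_permutation_transfer fame famf bij_nu
  (Nakayama_socle_permutation famf nak).
exists nu'; split=> // B2 nu2 hdeg2 nak2; apply/funext => i.
have [ex2 _] := Nakayama_socle_permutation fame nak2 i.
by have [_ /(_ _ ex2)] := soc' i.
Qed.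

(** * Forms of different degrees on the group algebra of a group of order two *)

Section GroupAlgebra.
Context (K : fieldType).

(** [bool], with exclusive or as addition, is the grading group [Z/2]; a pair
    [(x, y)] stands for [x + y t] with [t ^ 2 = 1] and [t] of degree [true]. *)
Let V : lmodType K := (K^o * K^o)%type.

Definition ga_mul (a b : V) : V :=
  (a.1 * b.1 + a.2 * b.2, a.1 * b.2 + a.2 * b.1).

Lemma ga_mul_bilinear : bilinear_for *:%R *:%R (ga_mul : V -> V -> V).
Proof.
have pairE c (u v : V) : c *: u + v = (c * u.1 + v.1, c * u.2 + v.2) by [].
split=> -[u1 u2] c [v1 v2] [w1 w2]; rewrite !pairE /ga_mul /=;
  congr (_, _); ring.
Qed.

HB.instance Definition _ := bilinear_isBilinear.Build K V V V *:%R *:%R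
  ga_mul ga_mul_bilinear.

Lemma ga_mulA : associative ga_mul.
Proof. by move=> [a1 a2] [b1 b2] [c1 c2]; rewrite /ga_mul /=; congr (_, _); ring. Qed.

Definition ga_coef (h : bool) (a : V) : K := if h then a.2 else a.1.

Definition ga_monomial (h : bool) (x : K) : V := if h then (0, x) else (x, 0).

Definition ga_comp (h : bool) : set V := [set a | ga_coef (~~ h) a = 0].

Lemma ga_comp_monomial h a : ga_comp h a <-> a = ga_monomial h (ga_coef h a).
Proof. by case: h; case: a => x y; rewrite /ga_comp /ga_monomial /=; split=> [->|[]]. Qed.

Lemma ga_coef_linear h c (a b : V) :
  ga_coef h (c *: a + b) = c * ga_coef h a + ga_coef h b.
Proof. by case: h. Qed.

Lemma ga_comp_direct : direct_sum ga_comp setT.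
Proof.
have fsum (f : bool -> V) : \sum_(h \in setT) f h = f true + f false.
  rewrite (@fsum_wider _ _ f [:: true; false]) //; last by case.
  by rewrite big_cons big_seq1.
split=> // [h|x _].
  split=> //; split=> [|c u v]; first by case: h.
  by rewrite /ga_comp /mkset ga_coef_linear => -> ->; rewrite mulr0 addr0.
exists (fun h => ga_monomial h (ga_coef h x)); split.
  split.
  - by case.
  - exact: finite_finset.
  - by rewrite fsum; case: x => x y; congr pair; rewrite /= ?add0r ?addr0.
move=> f [fA _]; rewrite fsum => xE; apply/funext => h.
have /ga_comp_monomial -> := fA h; congr ga_monomial.
have := fA (~~ h); rewrite /ga_comp /mkset negbK xE.
by case: h => /= ->; rewrite ?addr0 ?add0r.
Qed.

Lemma ga_compM (h k : bool) (a b : V) :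
  ga_comp h a -> ga_comp k b -> ga_comp (h + k) (ga_mul a b).
Proof.
by case: h k a b => -[] [a1 a2] [b1 b2]; rewrite /ga_comp /= => -> ->; ring.
Qed.

Definition group_algebra : gradedAlgebra K bool :=
  @GradedAlgebra K bool V ga_mul ga_mulA ga_comp ga_comp_direct ga_compM.

Lemma ga_mulC (a b : group_algebra) : a ** b = b ** a.
Proof. by case: a b => a1 a2 [b1 b2]; congr (_, _) => /=; ring. Qed.

Definition ga_one (i : unit) : group_algebra := (1, 0).

Lemma ga_mul1l i (a : group_algebra) : ga_one i ** a = a.
Proof. by case: a => x y; congr (_, _) => /=; ring. Qed.

Lemma ga_mul1r i (a : group_algebra) : a ** ga_one i = a.
Proof. by rewrite ga_mulC ga_mul1l. Qed.

Lemma ga_peirce i j : peirce (ga_one i) (ga_one j) = setT.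
Proof.
by apply/seteqP; split=> // a _; exists a; rewrite // ga_mul1l ga_mul1r.
Qed.

Lemma ga_peirce_comp i j h :
  peirce_comp (ga_one i) h (ga_one j) = gcomp group_algebra h.
Proof.
apply/seteqP; split=> [_ [a ah <-]|a ah]; first by rewrite ga_mul1l ga_mul1r.
by exists a; rewrite // ga_mul1l ga_mul1r.
Qed.

Lemma ga_distinguished : distinguished_family ga_one.
Proof.
have fsum (f : unit -> group_algebra) : \sum_(i \in setT) f i = f tt.
  by rewrite (@fsum_wider _ _ f [:: tt]) ?big_seq1 //; case.
have dir (N : unit -> set group_algebra) :
    (forall i, N i = setT) -> direct_sum N setT.
  move=> NT; split=> // [i|x _]; first by rewrite NT.
  exists (fun=> x); split.
    by split=> [i||]; [rewrite NT|exact: finite_finset|rewrite fsum].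
  by move=> f [_ _ ->]; rewrite fsum; apply/funext => -[].
split.
- move=> i; split; last by [].
  by apply/eqP => -[/eqP]; rewrite oner_eq0.
- by move=> i; rewrite ga_mul1l.
- by case=> -[].
- apply: dir => i; apply/seteqP; split=> // a _.
  by exists a; rewrite ?ga_mul1l.
- apply: dir => i; apply/seteqP; split=> // a _.
  by exists a; rewrite ?ga_mul1r.
Qed.

Lemma ga_local : local_subalgebra (gcomp group_algebra false).
Proof.
set S := gcomp group_algebra false.
have SE a : S a -> a = (a.1, 0) by move=> /ga_comp_monomial.
have S1 x : S (x, 0) by [].
have ideal0 N : left_ideal_of S N -> N `<` S -> N = [set 0].
  move=> [[N0 lN] NS NM] [_ SN]; apply/seteqP; split=> [a Na|_ -> //].
  have aE := SE _ (NS _ Na).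
  have [a0|a0] := eqVneq a.1 0; first by rewrite aE a0.
  case: SN => b /SE ->.
  suff <- : ((b.1 / a.1, 0) : group_algebra) ** a = (b.1, 0) by apply: NM.
  rewrite aE; congr (_, _); rewrite /= ?mul0r ?mulr0 ?addr0 //.
  by rewrite divfK.
have max0 : maximal_in (left_ideal_of S) S [set 0].
  split.
  - split.
    + by split=> // c u v -> ->; rewrite /= scaler0 addr0.
    + by move=> _ ->; apply: (gcomp_subspace group_algebra false).1.
    + by move=> a x _ ->; rewrite gmul0r.
  - split; first by move=> _ ->; apply: (gcomp_subspace group_algebra false).1.
    by move=> /(_ _ (S1 1)) [/eqP]; rewrite oner_eq0.
  - by move=> N iN NS _; apply: ideal0.
exists [set 0]; split=> // L [iL LS _].
by rewrite (ideal0 L).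
Qed.

Lemma ga_weakly_basic : weakly_basic_family ga_one.
Proof.
split=> [|i j h|i|].
- exact: ga_distinguished.
- rewrite ga_peirce_comp; exists 1, (fun=> ga_monomial h 1); split.
    by move=> _; case: h.
  move=> x xh; exists (fun=> ga_coef h x).
  rewrite big_ord1 {1}((ga_comp_monomial h x).1 xh).
  by case: h {xh}; congr (_, _); rewrite /GRing.scale /= ?mulr1 ?mulr0.
- by rewrite ga_peirce_comp; apply: ga_local.
- by case=> -[].
Qed.

(** The coefficient of degree [d] of the product is nondegenerate for both [d],
    because the monomial of degree [d] is invertible. *)
Definition ga_form (d : bool) (a b : group_algebra) : K := ga_coef d (a ** b).

Lemma ga_form_bilinear d :
  bilinear_for *%R *%R (ga_form d : group_algebra -> group_algebra -> K).
Proof.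
split=> u c v w; rewrite /ga_form.
  by rewrite linearPl ga_coef_linear.
by rewrite linearPr ga_coef_linear.
Qed.

HB.instance Definition _ d := bilinear_isBilinear.Build K group_algebra
  group_algebra K *%R *%R (ga_form d) (ga_form_bilinear d).

Lemma ga_form_represents d (phi : group_algebra -> K) :
  graded_dual setT phi ->
  exists! w, setT w /\ forall v, setT v -> ga_form d v w = phi v.
Proof.
move=> [phi_lin _].
have regular_scaleE (c t : K) : c *: (t : K^o) = c * t by [].
have phiE x y : phi (x, y) = x * phi (1, 0) + y * phi (0, 1).
  have phi0 : phi 0 = 0.
    have := phi_lin 1 0 0 Logic.I Logic.I.
    by rewrite scale1r addr0 mul1r -{1}[phi 0]addr0 => /addrI.
  have := phi_lin x (1, 0) (y *: (0, 1)) Logic.I Logic.I.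
  have := phi_lin y (0, 1) 0 Logic.I Logic.I.
  rewrite phi0 !addr0 => -> <-; congr phi; congr (_, _);
  by rewrite /= !regular_scaleE ?mulr1 ?mulr0 ?addr0 ?add0r.
exists (if d then (phi (0, 1), phi (1, 0)) else (phi (1, 0), phi (0, 1))).
split.
  split=> // -[x y] _; rewrite phiE.
  by rewrite /ga_form; case: d; rewrite /= // addrC.
move=> [w1 w2] [_ wP].
have := wP (1, 0) Logic.I; have := wP (0, 1) Logic.I.
by rewrite /ga_form; case: (d) => /=;
  rewrite ?mul1r ?mul0r ?addr0 ?add0r => -> ->.
Qed.

Lemma ga_form_Nakayama d :
  graded_Nakayama_form ga_one (ga_form d : {biscalar group_algebra}) id (fun=> d).
Proof.
split.
- by move=> a b c; rewrite /= /ga_form gmulA.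
- case; split; last by case.
  exists (ga_monomial d 1), (ga_one tt).
  rewrite /= /ga_form ga_mul1l !ga_mul1r.
  by case: d; apply: oner_neq0.
- by exists id.
- move=> i j; rewrite !ga_peirce; split.
    move=> h k v w [_ vh] [_ wk]; apply: contra_neq_eq => hk.
    have /ga_comp_monomial vw : ga_comp (h + k) (v ** w) by apply: ga_compM.
    rewrite -[LHS]/(ga_coef d (v ** w)) vw.
    by move: hk; case: (h + k) d => -[].
  split=> phi /(ga_form_represents d) [w [[_ wP] wU]]; exists w; split=> //.
  + by split=> // a _; rewrite -wP //= /ga_form ga_mulC.
  + by move=> x [_ xP]; apply: wU; split=> // a _; rewrite -xP //= /ga_form ga_mulC.
Qed.

Lemma ga_pseudo_Frobenius : graded_pseudo_Frobenius group_algebra.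
Proof.
exists unit, ga_one; split; first exact: ga_weakly_basic.
by exists (ga_form false), id, (fun=> false); apply: ga_form_Nakayama.
Qed.

End GroupAlgebra.

Theorem proposition3p2 (K : fieldType) :
  (forall (H : zmodType) (A : gradedAlgebra K H), graded_pseudo_Frobenius A ->
     forall (I : choiceType) (e : I -> A), weakly_basic_family e ->
       left_graded_socle A = right_graded_socle A
       /\ exists nu : I -> I,
            [/\ bijective nu,
                forall (B : {biscalar A}) (nu' : I -> I) (hdeg : I -> H),
                  graded_Nakayama_form e B nu' hdeg -> nu' = nu
              & forall i : I,
                  unique (fun j => exists2 s, left_graded_socle A s
                                            & e i ** s ** e j != 0) (nu i)])
  /\ (exists (H : zmodType) (A : gradedAlgebra K H),
        graded_pseudo_Frobenius A
        /\ exists (I : choiceType) (e : I -> A), weakly_basic_family e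
        /\ exists (B1 B2 : {biscalar A}) (nu1 nu2 : I -> I)
                  (hdeg1 hdeg2 : I -> H),
             [/\ graded_Nakayama_form e B1 nu1 hdeg1,
                 graded_Nakayama_form e B2 nu2 hdeg2
               & exists i : I, hdeg1 i != hdeg2 i]).
Proof.
split=> [H A pfA I e wbe|]; first exact: weakly_basic_socle.
exists bool, (group_algebra K); split; first exact: ga_pseudo_Frobenius.
exists unit, (@ga_one K); split; first exact: ga_weakly_basic.
exists (ga_form false), (ga_form true), id, id, (fun=> false), (fun=> true).
by split; [exact: ga_form_Nakayama|exact: ga_form_Nakayama|exists tt].
Qed.
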